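(* Assume (A2), (A3), (B1) and (B2). Then any measurable choice $x^\star(b_n)$ of an optimal solution of $(\mathrm{P}_{b_n})$ satisfies $$r_n\big(x^\star(b_n)-x^\star(b)\big)\xrightarrow{D}\sum_{k=1}^K\mathbb{1}\Big\{G\in H_k\setminus\bigcup_{j<k}H_j\Big\}\,x(I_k,G)\in\mathbb{R}^d,$$ with $H_k\subseteq\mathbb{R}^m$ the closed convex cones defined below (no joint convergence assumption on any weights is needed). If moreover $G$ is absolutely continuous, the indicators may be replaced by $\mathbb{1}\{G\in H_k\}$.
   Context: Setting: $A\in\mathbb{R}^{m\times d}$ of full rank $m\le d$, $b\in\mathbb{R}^m$, $c\in\mathbb{R}^d$. $(\mathrm{P}_\beta)$: $\min c^Tx$ s.t. $Ax=\beta,x\ge0$; $(\mathrm{D}_\beta)$: $\max\beta^T\lambda$ s.t. $A^T\lambda\le c$. A basis is $I\subseteq[d]$ with $|I|=m$, $A_I$ invertible; $x(I,v)\in\mathbb{R}^d$ has coordinates $(A_I)^{-1}v$ on $I$ and $0$ elsewhere; $\lambda(I)=(A_I)^{-T}c_I$; $I$ is dual feasible if $A^T\lambda(I)\le c$. Let $I_1,\dots,I_N$ enumerate all dual feasible bases with $I_1,\dots,I_K$ exactly those with $x(I_k,b)\ge0$. (A2): $(\mathrm{P}_b)$ has a unique optimal solution $x^\star(b)$. (A3): $\lambda(I_j)\ne\lambda(I_k)$ for $1\le j<k\le K$. Stochastic: $r_n\to\infty$, $m_0\in[m]$, random $b_n\in\mathbb{R}^m$ whose last $m-m_0$ coordinates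 equal those of $b$. (B1): $G_n:=r_n(b_n-b)\xrightarrow{D}G=(G^{m_0},0_{m-m_0})$ with $G^{m_0}$ absolutely continuous on $\mathbb{R}^{m_0}$. (B2): $\mathbb{P}((\mathrm{P}_{b_n})\text{ has an optimal solution})\to1$. Cones: $\mathrm{Pos}=\{i:x^\star_i(b)>0\}$; for $k\le K$ write $I_k=\{i^k_1<\dots<i^k_m\}$, $J_k=\{j\in[m]:i^k_j\notin\mathrm{Pos}\}$, and $H_k=\{v\in\mathbb{R}^m:[(A_{I_k})^{-1}v]_j\ge0\ \forall j\in J_k\}$. *)

(* Defs.v *)
From HB Require Import structures.
From mathcomp Require Import all_boot all_order all_algebra.
From mathcomp Require Import all_classical all_reals all_analysis.
Set Implicit Arguments. Unset Strict Implicit. Unset Printing Implicit Defensive.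
Import Order.TTheory GRing.Theory Num.Theory.
Import numFieldNormedType.Exports.
Local Open Scope classical_set_scope.
Local Open Scope ring_scope.

Section LP.
Variables (R : realType) (m d : nat) (A : 'M[R]_(m, d)) (c : 'cV[R]_d).

Definition lp_feasible (beta : 'cV[R]_m) (x : 'cV[R]_d) : Prop :=
  A *m x = beta /\ forall i, 0 <= x i 0.

Definition lp_cost (x : 'cV[R]_d) : R := \sum_(i < d) c i 0 * x i 0.

Definition lp_optimal (beta : 'cV[R]_m) (x : 'cV[R]_d) : Prop :=
  lp_feasible beta x /\ forall y, lp_feasible beta y -> lp_cost x <= lp_cost y.

Definition has_optimal (beta : 'cV[R]_m) : Prop := exists x, lp_optimal beta x.

(* A basis I = {i_1 < ... < i_m} is encoded by the strictly increasing map
   j |-> i_j from 'I_m to 'I_d; A_I = colsub f A. *)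
Definition is_basis (f : {ffun 'I_m -> 'I_d}) : Prop :=
  (forall i j : 'I_m, (i < j)%N -> (f i < f j)%N) /\ colsub f A \in unitmx.

Definition xB (f : {ffun 'I_m -> 'I_d}) (v : 'cV[R]_m) : 'cV[R]_d :=
  \col_(i < d) (if [pick j | f j == i] is Some j
                then (invmx (colsub f A) *m v) j 0 else 0).

Definition lamB (f : {ffun 'I_m -> 'I_d}) : 'cV[R]_m :=
  invmx (colsub f A)^T *m rowsub f c.

Definition dual_feasible (f : {ffun 'I_m -> 'I_d}) : Prop :=
  forall i, (A^T *m lamB f) i 0 <= c i 0.

(* H_k for the basis f, given x*(b) = xb:
   J = {j : i_j not in Pos}, H = {v : [(A_I)^{-1} v]_j >= 0 for j in J} *)
Definition Hcone (xb : 'cV[R]_d) (f : {ffun 'I_m -> 'I_d}) : set 'cV[R]_m :=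
  [set v | forall j : 'I_m, ~ (0 < xb (f j) 0) ->
                          0 <= (invmx (colsub f A) *m v) j 0].

Definition lim_vec (xb : 'cV[R]_d) (Ks : seq {ffun 'I_m -> 'I_d})
  (v : 'cV[R]_m) : 'cV[R]_d :=
  \sum_(k < size Ks)
     \1_(Hcone xb (tnth (in_tuple Ks) k)
         `\` \bigcup_(j in [set j : 'I_(size Ks) | (j < k)%N])
                Hcone xb (tnth (in_tuple Ks) j)) v
     *: xB (tnth (in_tuple Ks) k) v.

Definition lim_vec' (xb : 'cV[R]_d) (Ks : seq {ffun 'I_m -> 'I_d})
  (v : 'cV[R]_m) : 'cV[R]_d :=
  \sum_(k < size Ks) \1_(Hcone xb (tnth (in_tuple Ks) k)) v
     *: xB (tnth (in_tuple Ks) k) v.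

End LP.

(* Random vectors in R^k (column vectors); Borel measurability on R^k is
   equivalently measurability of every coordinate. *)
Definition rvec_measurable (R : realType) (dO : measure_display)
  (O : measurableType dO) (k : nat) (X : O -> 'cV[R]_k) : Prop :=
  forall i : 'I_k, measurable_fun setT (fun w => X w i 0).

Definition lebesgue_null (R : realType) (k : nat) (S : set 'cV[R]_k) : Prop :=
  forall eps : R, 0 < eps ->
  exists lo hi : nat -> 'cV[R]_k,
    (forall n i, lo n i 0 <= hi n i 0) /\
    (S `<=` \bigcup_n [set v | forall i, lo n i 0 <= v i 0 <= hi n i 0]) /\
    (forall N, \sum_(n < N) \prod_(i < k) (hi n i 0 - lo n i 0) <= eps).

Definition abs_cont (R : realType) (dO : measure_display)
  (O : measurableType dO) (Q : probability O R) (k : nat)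
  (Y : O -> 'cV[R]_k) : Prop :=
  forall S : set 'cV[R]_k, lebesgue_null S ->
    exists E : set O, [/\ measurable E, Y @^-1` S `<=` E & Q E = 0%E].

Definition proj_first (R : realType) (m0 m : nat) (v : 'cV[R]_m) : 'cV[R]_m0 :=
  \col_(i < m0) (match (insub (nat_of_ord i) : option 'I_m) with
                 | Some j => v j 0 | None => 0 end).

Definition conv_dist (R : realType) (dO : measure_display)
  (O : measurableType dO) (P : probability O R) (dO' : measure_display)
  (O' : measurableType dO') (Q : probability O' R) (k : nat)
  (X : nat -> O -> 'cV[R]_k) (Y : O' -> 'cV[R]_k) : Prop :=
  forall f : 'cV[R]_k -> R, continuous f -> (exists M : R, forall v, `|f v| <= M) ->
    ((fun n => \int[P]_w (f (X n w))%:E) @ \oo --> \int[Q]_w (f (Y w))%:E)%E.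

(* Main.v *)
(* Every optimal solution of (P_beta) is complementary to a dual optimum (Farkas);
   shrinking its support and enlarging the tight set of the dual optimum yields a
   basis that is both primal and dual feasible. By (A2) and (A3) the reduced costs
   of the bases in [Ks] are positive off the basis, so for beta near b with an
   optimum, x(I_k, beta) is the only optimal solution as soon as it is
   nonnegative, which then means [G_n] in [H_k]. Two such solutions coincide
   on [H_j] and [H_k] simultaneously, so the limit map is continuous on the closed
   set [C], the union of the cones, and r_n (x*(b_n) - x*(b)) is its value at G_n,
   except on an event whose probability tends to 0. Hence G is in [C] almost
   surely, and the limit map, extended from [C] by Tietze's theorem, preserves
   convergence in distribution. Finally, on [H_j] and [H_k], j <> k, a coordinate of
   x(I_j, .) vanishes, so that the overlap lies in a hyperplane. *)
Require Import Defs.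
From HB Require Import structures.
From mathcomp Require Import all_boot all_order all_algebra.
From mathcomp Require Import all_classical all_reals all_analysis.
From mathcomp Require Import measurable_realfun ring lra.
Import Order.TTheory GRing.Theory Num.Theory.
Import numFieldNormedType.Exports.
Local Open Scope classical_set_scope.
Local Open Scope ring_scope.
Set Implicit Arguments. Unset Strict Implicit. Unset Printing Implicit Defensive.

(** * Farkas' lemma *)

(* Induction on the number of forms (D. Bartl): a point xbar violating the
   implication for all forms but the first, normalised so that the first form
   takes the value 1 there, allows one to eliminate the first form. *)
Lemma farkas_ord (K : realFieldType) (W : lmodType K) n (a : 'I_n -> W -> K)
    (g : W -> K) :
  (forall i, scalar (a i)) -> scalar g ->
  (forall x, (forall i, a i x <= 0) -> g x <= 0) ->
  exists2 l : 'I_n -> K, forall i, 0 <= l i &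
    forall x, g x = \sum_i l i * a i x.
Proof.
elim: n a g => [|n IH] a g sa sg ag.
  exists (fun=> 0) => [//|x]; rewrite big_ord0.
  have gN : g (- x) = - g x.
    have := sg (-1) x 0; rewrite scaleN1r addr0 => ->.
    by have := sg (-1) 0 0; rewrite scaler0 addr0 mulN1r; lra.
  by apply/eqP; rewrite eq_le -oppr_le0 -gN !ag // => -[].
(* If the first form is redundant, it gets the multiplier 0. *)
have [h|] := pselect (forall x, (forall i, a (lift ord0 i) x <= 0) -> g x <= 0).
  have [l l0 gl] := IH _ _ (fun i => sa (lift ord0 i)) sg h.
  exists (fun i => oapp l 0 (unlift ord0 i)) => [i|x].
    by case: unliftP => //= j _.
  by rewrite gl big_ord_recl unlift_none /= mul0r add0r; apply: eq_bigr => i _;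
     rewrite liftK.
move/existsNP => [z /not_implyP [az /negP]]; rewrite -ltNge => gz.
pose h := a ord0.
have hz : 0 < h z.
  rewrite ltNge; apply/negP => hz; move: gz; rewrite ltNge => /negP; apply.
  by apply: ag => i; case: (unliftP ord0 i) => [j|] ->.
pose zb := (h z)^-1 *: z.
have s0 (k : W -> K) : scalar k -> k 0 = 0.
  by move=> sk; have := sk (-1) 0 0; rewrite scaler0 addr0 mulN1r; lra.
have sZ (k : W -> K) t x : scalar k -> k (t *: x) = t * k x.
  by move=> sk; rewrite -[in LHS](addr0 (t *: x)) sk (s0 _ sk) addr0.
have hzb : h zb = 1 by rewrite sZ ?mulVf ?gt_eqF //; exact: sa.
have azb i : a (lift ord0 i) zb <= 0.
  by rewrite sZ ?pmulr_rle0 ?invr_gt0 //; exact: sa.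
have gzb : 0 < g zb by rewrite sZ ?mulr_gt0 ?invr_gt0.
(* [- h x *: zb + x] is the projection of [x] along [zb] onto the kernel of the first form. *)
have spr (k : W -> K) x : scalar k -> k (- h x *: zb + x) = k x - k zb * h x.
  by move=> sk; rewrite sk; ring.
have ssub (k : W -> K) : scalar k -> scalar (fun x => k x - k zb * h x).
  by move=> sk t x y /=; rewrite sk (sa ord0 t x y : h _ = t * h x + h y); ring.
have [||l l0 gl] := IH (fun i x => a (lift ord0 i) x - a (lift ord0 i) zb * h x)
                (fun x => g x - g zb * h x) _ (ssub _ sg).
- by move=> i; exact: ssub.
- move=> x ax; rewrite -spr //; apply: ag => i.
  case: (unliftP ord0 i) => [j|] ->; first by rewrite spr; [exact: ax|exact: sa].
  by rewrite -/h spr ?hzb; [rewrite mul1r subrr|exact: sa].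
exists (fun i => oapp l (g zb - \sum_i l i * a (lift ord0 i) zb) (unlift ord0 i)).
  move=> i; case: unliftP => //= _; rewrite subr_ge0.
  by apply: le_trans (ltW gzb); apply: sumr_le0 => j _; apply: mulr_ge0_le0.
move=> x; rewrite big_ord_recl unlift_none /=.
have -> : g x = (g x - g zb * h x) + g zb * h x by ring.
rewrite gl -/h mulrBl addrC -addrA; congr (_ + _).
rewrite mulr_suml -sumrN -big_split /=; apply: eq_bigr => i _.
by rewrite liftK /=; ring.
Qed.

Lemma farkas (K : realFieldType) (W : lmodType K) (I : finType)
    (a : I -> W -> K) (g : W -> K) :
  (forall i, scalar (a i)) -> scalar g ->
  (forall x, (forall i, a i x <= 0) -> g x <= 0) ->
  exists2 l : I -> K, forall i, 0 <= l i &
    forall x, g x = \sum_i l i * a i x.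
Proof.
move=> sa sg ag.
have [||l l0 gl] := @farkas_ord K W #|I| (fun i => a (enum_val i)) g _ sg.
- by move=> i; exact: sa.
- by move=> x ax; apply: ag => i; have := ax (enum_rank i); rewrite enum_rankK.
exists (l \o enum_rank) => [i|x]; first exact: l0.
rewrite gl (reindex enum_rank) /=; last first.
  by exists enum_val => i _; rewrite ?enum_valK ?enum_rankK.
by apply: eq_bigr => i _; rewrite enum_rankK.
Qed.

(** The least ratio [u i / - v i] over [v i < 0] is the longest step preserving nonnegativity. It is
    positive because [u] is positive wherever [v] is negative, and the minimizing index drops to
    0. *)
Lemma ratio_test (K : realFieldType) (I : finType) (u v : I -> K) :
  (forall i, 0 <= u i) -> (forall i, u i = 0 -> 0 <= v i) ->
  (exists i, v i < 0) ->
  exists t, [/\ 0 < t, forall i, 0 <= u i + t * v i &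
    exists2 i, u i != 0 & u i + t * v i = 0].
Proof.
move=> u0 uv [i0 vi0].
have upos i : v i < 0 -> 0 < u i.
  move=> vi; rewrite lt_neqAle u0 andbT eq_sym; apply/eqP => ui.
  by have := uv _ ui; rewrite leNgt vi.
case: (@Order.TotalTheory.arg_minP _ _ _ i0 (fun i => v i < 0)
  (fun i => u i / - v i) vi0) => i vi imin.
have ni : 0 < - v i by rewrite oppr_gt0.
exists (u i / - v i); split; first by rewrite divr_gt0 ?upos.
  move=> j; have [vj|vj] := ltP (v j) 0; last first.
    by apply: addr_ge0 => //; apply: mulr_ge0 => //; apply: divr_ge0 => //; exact: ltW.
  have := imin j vj; rewrite [_ <= u j / _]ler_pdivlMr ?oppr_gt0 // => h.
  by rewrite -[v j]opprK mulrN subr_ge0.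
exists i; first by rewrite gt_eqF ?upos.
by rewrite -[X in _ * X]opprK mulrN divfK ?subrr ?gt_eqF.
Qed.

Lemma feasible_step (K : realFieldType) (I : finType) (u v : I -> K) :
  (forall i, 0 <= u i) -> (forall i, u i = 0 -> 0 <= v i) ->
  exists2 t, 0 < t & forall i, 0 <= u i + t * v i.
Proof.
move=> u0 uv; have [/(ratio_test u0 uv)[t [t0 h _]]|] := pselect (exists i, v i < 0).
  by exists t.
move/forallNP => h; exists 1 => // i; rewrite mul1r addr_ge0 //.
by rewrite leNgt; apply/negP/h.
Qed.

(** * Bases and optimal solutions *)

Section basis_theory.
Variables (R : realType) (m d : nat) (A : 'M[R]_(m, d)) (c : 'cV[R]_d).

Definition col_indep (S : {set 'I_d}) := forall x : 'cV[R]_d,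
  A *m x = 0 -> (forall i, i \notin S -> x i 0 = 0) -> x = 0.

(** The columns in [S] span the whole space, expressed through their orthogonal complement. *)
Definition col_spanning (S : {set 'I_d}) := forall y : 'cV[R]_m,
  (forall i, i \in S -> (A^T *m y) i 0 = 0) -> y = 0.

Lemma dot_adjoint (y : 'cV[R]_m) (x : 'cV[R]_d) :
  \sum_i (A^T *m y) i 0 * x i 0 = \sum_j y j 0 * (A *m x) j 0.
Proof.
have -> : \sum_i (A^T *m y) i 0 * x i 0 = ((A^T *m y)^T *m x) 0 0.
  by rewrite mxE; apply: eq_bigr => i _; congr (_ * _); rewrite [in RHS]mxE.
rewrite trmx_mul trmxK -mulmxA mxE; apply: eq_bigr => j _.
by congr (_ * _); rewrite mxE.
Qed.

(** A nonzero [y] orthogonal to the columns in [S] fails to be orthogonal to some column [i] of [T],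
    and this column can be added to [S]. *)
Lemma extend_to_basis_set (S T : {set 'I_d}) :
  S \subset T -> col_indep S -> col_spanning T ->
  exists I : {set 'I_d},
    [/\ S \subset I, I \subset T, col_indep I & col_spanning I].
Proof.
have [k] := ubnP #|T :\: S|; elim: k S => // k IH S kS ST iS sT.
have [sS|] := pselect (col_spanning S); first by exists S; split.
move/existsNP => [y /not_implyP [yS y0]].
have [i iT yi] : exists2 i, i \in T & (A^T *m y) i 0 != 0.
  apply: contrapT => h; apply/y0/sT => i iT; apply/eqP; apply: contrapT => /negP yi.
  by apply: h; exists i.
have iNS : i \notin S by apply/negP => /yS /eqP; rewrite (negbTE yi).
have [||||I [SI IT iI sI]] := IH (i |: S).
- rewrite -ltnS; apply: leq_trans kS; rewrite ltnS; apply/proper_card/properP; split.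
    by exact/finset.setDS/finset.subsetUr.
  by exists i; rewrite !inE ?eqxx //= iNS.
- by rewrite finset.subUset finset.sub1set iT.
(* Pairing the relation [A *m x = 0] with [y] leaves only the term of [i], so [x i 0] is 0. *)
- move=> x Ax xS; apply: iS => // j jS; have [->|ji] := eqVneq j i; last first.
    by apply: xS; rewrite !inE negb_or ji.
  have := dot_adjoint y x; rewrite Ax [RHS]big1 => [|k' _]; last by rewrite mxE mulr0.
  rewrite (bigD1 i) //= big1 ?addr0 => [/eqP|k' k'i].
    by rewrite mulf_eq0 (negbTE yi) => /eqP.
  have [k'S|k'S] := boolP (k' \in S); first by rewrite yS ?mul0r.
  by rewrite xS ?mulr0 // !inE negb_or k'i.
- by [].
by exists I; split => //; exact: fintype.subset_trans (finset.subsetUr _ _) SI.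
Qed.

(** The length [k] is arbitrary, so that both [xB] and the enumeration of a set not yet known to
    have [m] elements are covered. *)
Definition expand k (f : 'I_k -> 'I_d) (w : 'cV[R]_k) : 'cV[R]_d :=
  \col_i (if [pick j | f j == i] is Some j then w j 0 else 0).

Lemma expandE k (f : 'I_k -> 'I_d) w j :
  injective f -> expand f w (f j) 0 = w j 0.
Proof.
move=> fI; rewrite mxE; case: pickP => [j' /eqP /fI -> //|/(_ j)].
by rewrite eqxx.
Qed.

Lemma expand_off k (f : 'I_k -> 'I_d) w i :
  (forall j, f j != i) -> expand f w i 0 = 0.
Proof. by move=> fi; rewrite mxE; case: pickP => // j; rewrite (negbTE (fi j)). Qed.

Lemma restrictK k (f : 'I_k -> 'I_d) (x : 'cV[R]_d) :
  (forall i, (forall j, f j != i) -> x i 0 = 0) -> expand f (rowsub f x) = x.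
Proof.
move=> xf; apply/colP => i; rewrite mxE; case: pickP => [j /eqP <-|h].
  by rewrite mxE.
by rewrite xf // => j; rewrite h.
Qed.

Lemma mulmx_expand k (f : 'I_k -> 'I_d) w :
  injective f -> A *m expand f w = colsub f A *m w.
Proof.
move=> fI; apply/colP => i; rewrite !mxE.
rewrite (bigID (fun j => j \in codom f)) /= addrC big1 ?add0r; last first.
  move=> j jf; rewrite expand_off ?mulr0 // => l; apply: contra jf => /eqP <-.
  exact: codom_f.
rewrite (reindex_omap f (fun i => [pick j | f j == i])) /=; last first.
  move=> j /codomP [l ->]; case: pickP => /= [l' /eqP -> //|/(_ l)].
  by rewrite eqxx.
apply: eq_big => [j|j _]; last by rewrite expandE // !mxE.
rewrite codom_f /=; case: pickP => [l /eqP /fI -> //|/(_ j)]; first by rewrite eqxx.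
by rewrite eqxx.
Qed.

Lemma colsubK k (f : 'I_k -> 'I_d) (x : 'cV[R]_d) : injective f ->
  (forall i, (forall j, f j != i) -> x i 0 = 0) ->
  A *m x = colsub f A *m rowsub f x.
Proof. by move=> fI xf; rewrite -mulmx_expand // restrictK. Qed.

Lemma increasing_enum (I : {set 'I_d}) : #|I| = m ->
  exists2 f : {ffun 'I_m -> 'I_d},
    (forall i j : 'I_m, (i < j)%N -> (f i < f j)%N) &
    (forall i, i \in I <-> exists j, f j = i).
Proof.
move=> Im; exists [ffun j => Order.enum_val (cast_ord (esym Im) j)].
  move=> i j ij; rewrite !ffunE.
  by have := leW_mono (@Order.le_enum_val _ _ (@le_total _ _) (mem I)) (cast_ord (esym Im) i)
    (cast_ord (esym Im) j); rewrite !ltEord /= ij.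
move=> i; split=> [iI|[j <-]]; last by rewrite ffunE Order.enum_valP.
exists (cast_ord Im (Order.enum_rank_in iI i)).
by rewrite ffunE cast_ordK Order.enum_rankK_in.
Qed.

Lemma increasing_inj (f : {ffun 'I_m -> 'I_d}) :
  (forall i j : 'I_m, (i < j)%N -> (f i < f j)%N) -> injective f.
Proof.
move=> fm i j fij; apply/val_inj/eqP; rewrite eqn_leq; apply/andP; split.
  by rewrite leqNgt; apply/negP => /fm; rewrite fij ltnn.
by rewrite leqNgt; apply/negP => /fm; rewrite fij ltnn.
Qed.

Lemma basis_inj f : is_basis A f -> injective f.
Proof. by case=> /increasing_inj. Qed.

Lemma tr_colsub k (f : 'I_k -> 'I_d) : (colsub f A)^T = rowsub f A^T.
Proof. by apply/matrixP => i j; rewrite !mxE. Qed.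

Lemma spanning_row_free k (f : 'I_k -> 'I_d) (I : {set 'I_d}) :
  col_spanning I -> (forall i, i \in I -> exists j, f j = i) ->
  row_free (colsub f A).
Proof.
move=> sI fI; apply: inj_row_free => v vA; apply: trmx_inj; rewrite linear0.
apply: sI => i /fI[j <-]; have := congr1 trmx vA.
rewrite trmx_mul tr_colsub linear0 mul_rowsub_mx => /colP/(_ j).
by rewrite mxE => ->; rewrite mxE.
Qed.

(** Spanning makes the rows of the selected submatrix independent and independence its columns, so
    it is square: [#|I| = m]. *)
Lemma basis_of_set (I : {set 'I_d}) : col_indep I -> col_spanning I ->
  exists2 f, is_basis A f & (forall i, i \in I <-> exists j, f j = i).
Proof.
move=> iI sI; have cI : #|I| = m.
  pose g (j : 'I_#|I|) := enum_val j; pose B := colsub g A.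
  have gI : injective g := enum_val_inj.
  have rB : row_free B.
    apply: (spanning_row_free sI) => i iI'.
    by exists (enum_rank_in iI' i); rewrite /g enum_rankK_in.
  have rBt : row_free B^T.
    apply: inj_row_free => v vB; apply: trmx_inj; rewrite linear0.
    have Ae : A *m expand g v^T = 0.
      by rewrite mulmx_expand //; apply: trmx_inj; rewrite trmx_mul trmxK vB linear0.
    have /colP e0 : expand g v^T = 0.
      apply: iI => // i iNI; apply: expand_off => j; apply: contraNneq iNI => <-.
      exact: enum_valP.
    by apply/colP => j; have := e0 (g j); rewrite expandE // => ->; rewrite !mxE.
  by move: rB rBt; rewrite /row_free mxrank_tr => /eqP -> /eqP.
have [f fm fI] := increasing_enum cI; exists f => //; split=> //.
by rewrite -row_free_unit; apply: (spanning_row_free sI) => i /fI.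
Qed.

Lemma extend_to_basis (S T : {set 'I_d}) :
  S \subset T -> col_indep S -> col_spanning T ->
  exists f, [/\ is_basis A f, forall i, i \in S -> exists j, f j = i &
    forall j, f j \in T].
Proof.
move=> ST iS sT; have [I [SI IT iI sI]] := extend_to_basis_set ST iS sT.
have [f bf fI] := basis_of_set iI sI; exists f; split=> // [i iS'|j].
  by apply/fI; apply: (fintype.subsetP SI).
by apply: (fintype.subsetP IT); apply/fI; exists j.
Qed.

Lemma xB_expand f v : xB A f v = expand f (invmx (colsub f A) *m v).
Proof. by []. Qed.

Lemma mulmx_xB f v : is_basis A f -> A *m xB A f v = v.
Proof.
move=> bf; rewrite xB_expand mulmx_expand; last exact: basis_inj.
by rewrite mulKVmx //; case: bf.
Qed.

Lemma xB_unique f v x : is_basis A f -> A *m x = v ->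
  (forall i, (forall j, f j != i) -> x i 0 = 0) -> x = xB A f v.
Proof.
move=> bf <- xf; rewrite xB_expand (colsubK (basis_inj bf) xf) mulKmx ?restrictK //.
by case: bf.
Qed.

Lemma lamB_tight f j : is_basis A f -> (A^T *m lamB A c f) (f j) 0 = c (f j) 0.
Proof.
move=> [_ bf]; have : rowsub f (A^T *m lamB A c f) = rowsub f c.
  by rewrite -mul_rowsub_mx -tr_colsub mulKVmx // unitmx_tr.
by move/colP/(_ j); rewrite !mxE.
Qed.

Lemma lamB_unique f y : is_basis A f ->
  (forall j, (A^T *m y) (f j) 0 = c (f j) 0) -> y = lamB A c f.
Proof.
move=> [_ bf] yf; rewrite /lamB.
have -> : rowsub f c = (colsub f A)^T *m y.
  by rewrite tr_colsub mul_rowsub_mx; apply/colP => j; rewrite [LHS]mxE -yf [RHS]mxE.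
by rewrite mulKmx // unitmx_tr.
Qed.

Lemma basis_spanning f (T : {set 'I_d}) : is_basis A f ->
  (forall j, f j \in T) -> col_spanning T.
Proof.
move=> [_ bf] fT y yT; have : (colsub f A)^T *m y = 0.
  by rewrite tr_colsub mul_rowsub_mx; apply/colP => j; rewrite mxE yT // mxE.
by move/(congr1 (mulmx (invmx (colsub f A)^T))); rewrite mulKmx ?unitmx_tr // mulmx0.
Qed.
End basis_theory.

(** * Duality, complementary slackness and optimal bases *)

Section duality.
Variables (R : realType) (m d : nat) (A : 'M[R]_(m, d)) (c : 'cV[R]_d).

(** The reduced cost of column [i] at [y]. *)
Definition dual_slack (y : 'cV[R]_m) i := c i 0 - (A^T *m y) i 0.

Definition tight (y : 'cV[R]_m) : {set 'I_d} := [set i | dual_slack y i == 0].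

Definition supp (x : 'cV[R]_d) : {set 'I_d} := [set i | x i 0 != 0].

(** On the feasible set of a fixed right-hand side the first sum is constant, so minimizing the cost
    means minimizing the slack term, which is nonnegative when [y] is dual feasible. *)
Lemma lp_cost_slack (y : 'cV[R]_m) (x : 'cV[R]_d) :
  lp_cost c x = \sum_j y j 0 * (A *m x) j 0 + \sum_i dual_slack y i * x i 0.
Proof.
by rewrite -dot_adjoint -big_split; apply: eq_bigr => i _; rewrite /dual_slack /=; ring.
Qed.

Lemma slack_sum_ge0 y (x : 'cV[R]_d) : (forall i, 0 <= dual_slack y i) ->
  (forall i, 0 <= x i 0) -> 0 <= \sum_i dual_slack y i * x i 0.
Proof. by move=> y0 x0; apply: sumr_ge0 => i _; apply: mulr_ge0. Qed.

Lemma slack_sum0 y x : supp x \subset tight y ->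
  \sum_i dual_slack y i * x i 0 = 0.
Proof.
move=> /fintype.subsetP xy; rewrite big1 // => i _; have [->|xi] := eqVneq (x i 0) 0.
  by rewrite mulr0.
by have := xy i; rewrite !inE xi => /(_ isT) /eqP ->; rewrite mul0r.
Qed.

Lemma complementary_optimal beta x y : lp_feasible A beta x ->
  (forall i, 0 <= dual_slack y i) -> supp x \subset tight y ->
  lp_optimal A c beta x.
Proof.
move=> [Ax x0] y0 xy; split=> // z [Az z0].
by rewrite !(lp_cost_slack y) Ax Az slack_sum0 // addr0 lerDl slack_sum_ge0.
Qed.

(** The slack term is 0 at [x], hence at most 0 at the optimal [z]; as a sum of nonnegative terms it
    vanishes term by term. *)
Lemma optimal_complementary beta x z y : lp_feasible A beta x ->
  (forall i, 0 <= dual_slack y i) -> supp x \subset tight y ->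
  lp_optimal A c beta z -> supp z \subset tight y.
Proof.
move=> fx y0 xy [[Az z0] /(_ _ fx)]; rewrite !(lp_cost_slack y) Az.
case: (fx) => -> _; rewrite (slack_sum0 xy) addr0 gerDl => h.
have /eqP : \sum_i dual_slack y i * z i 0 = 0.
  by apply/eqP; rewrite eq_le h slack_sum_ge0.
rewrite psumr_eq0 => [/allP h0|i _]; last exact: mulr_ge0.
apply/fintype.subsetP => i; rewrite !inE => zi.
by have := h0 i (mem_index_enum _); rewrite mulf_eq0 (negbTE zi) orbF.
Qed.

(** The cost cannot decrease along a feasible direction at [x]; the Farkas multipliers of this
    implication form the dual point. *)
Lemma optimal_dual beta x : lp_optimal A c beta x ->
  exists2 y, forall i, 0 <= dual_slack y i & supp x \subset tight y.
Proof.
move=> [[Ax x0] xopt].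
(* All forms are nonpositive exactly at the feasible directions: [A *m z = 0] is split into two
   signs, and [z i 0] must be nonnegative where [x i 0] vanishes. At the other indices the form is
   0. *)
pose a (k : 'I_m + 'I_m + 'I_d) (z : 'cV[R]_d) : R := match k with
  | inl (inl j) => (A *m z) j 0
  | inl (inr j) => - (A *m z) j 0
  | inr i => if x i 0 == 0 then - z i 0 else 0 end.
have [||z az|l l0 gl] := @farkas R _ _ a (fun z => - lp_cost c z).
- move=> [[j|j]|i] t u v /=; rewrite ?mulmxDr -?scalemxAr ?mxE //; first by ring.
  by case: ifP => _; rewrite ?mxE; ring.
- move=> t u v /=; rewrite /lp_cost mulrN -opprD mulr_sumr -big_split /=.
  by congr (- _); apply: eq_bigr => i _; rewrite !mxE; ring.
- have [||t t0 xt] := @feasible_step R _ (x^~ 0) (z^~ 0); first by [].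
    by move=> i xi; have := az (inr i); rewrite /= xi eqxx oppr_le0.
  have Az : A *m z = 0.
    apply/colP => j; rewrite [RHS]mxE; apply/eqP; rewrite eq_le (az (inl (inl j))).
    by rewrite -oppr_le0 (az (inl (inr j))).
  have /xopt : lp_feasible A beta (x + t *: z).
    split=> [|i]; last by rewrite !mxE.
    by rewrite mulmxDr -scalemxAr Az scaler0 addr0.
  have -> : lp_cost c (x + t *: z) = lp_cost c x + t * lp_cost c z.
    rewrite /lp_cost mulr_sumr -big_split /=.
    by apply: eq_bigr => i _; rewrite !mxE; ring.
  by rewrite lerDl pmulr_rge0 // oppr_le0.
pose y := \col_j (l (inl (inr j)) - l (inl (inl j))).
(* The slack is read off by evaluating the Farkas identity at a unit vector. *)
have key i : dual_slack y i = if x i 0 == 0 then l (inr i) else 0.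
  have := gl (delta_mx i 0); rewrite !big_sumType /=.
  have -> : lp_cost c (delta_mx i 0) = c i 0.
    rewrite /lp_cost (bigD1 i) //= big1 ?mxE ?eqxx ?mulr1 ?addr0 // => k ki.
    by rewrite mxE (negbTE ki) mulr0.
  rewrite (bigD1 (P := predT) i) //= [X in _ + (_ + X)]big1 => [|k ki]; last first.
    by rewrite mxE (negbTE ki) oppr0; case: ifP; rewrite mulr0.
  rewrite mxE !eqxx /= addr0 -big_split /= => h.
  have Ay : (A^T *m y) i 0 = - \sum_j (l (inl (inl j)) * (A *m delta_mx i 0 : 'cV_m) j 0
        + l (inl (inr j)) * - (A *m delta_mx i 0 : 'cV_m) j 0).
    rewrite mxE -sumrN; apply: eq_bigr => j _.
    by rewrite -colE !mxE; ring.
  rewrite /dual_slack Ay; move: h; case: ifP => _; lra.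
exists y => [i|]; first by rewrite key; case: ifP.
by apply/fintype.subsetP => i; rewrite !inE key => /negbTE ->.
Qed.

(** A relation among the columns of the support is a direction along which the ratio test removes
    one index. The support only shrinks, so complementarity with [y] preserves optimality. *)
Lemma minimal_support beta x : lp_optimal A c beta x ->
  exists2 x', lp_optimal A c beta x' & col_indep A (supp x').
Proof.
have [k] := ubnP #|supp x|; elim: k x => // k IH x xk xo.
have [ix|] := pselect (col_indep A (supp x)); first by exists x.
move/existsNP => [z /not_implyP [Az /not_implyP [zx z0]]].
have [y y0 xy] := optimal_dual xo.
(* As [z] is nonzero, [z] or [- z] has a negative entry. *)
wlog [i zi] : z Az zx z0 / exists i, z i 0 < 0.
  move=> wl; have [[i zi]|/forallNP zp] := pselect (exists i, z i 0 < 0).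
    by apply: (wl z) => //; exists i.
  apply: (wl (- z)); rewrite ?mulmxN ?Az ?oppr0 //.
  - by move=> i /zx; rewrite mxE => ->; rewrite oppr0.
  - by move/eqP; rewrite oppr_eq0 => /eqP.
  - apply: contrapT => /forallNP zn; apply: z0; apply/colP => i; rewrite [RHS]mxE.
    apply/eqP; rewrite eq_le; move: (zp i) (zn i); rewrite mxE oppr_lt0.
    by move=> /negP; rewrite -leNgt => -> /negP; rewrite -leNgt andbT.
have [||t [t0 xt [i' xi' xti']]] := @ratio_test R _ (x^~ 0) (z^~ 0) _ _ (ex_intro _ i zi).
- by case: xo => -[].
- by move=> j xj; rewrite zx // inE xj eqxx.
have sub : supp (x + t *: z) \subset supp x.
  apply/fintype.subsetP => j; rewrite !inE; apply: contraNneq => xj.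
  by rewrite !mxE xj zx ?mulr0 ?addr0 // inE xj eqxx.
apply: (IH (x + t *: z)).
  rewrite -ltnS; apply: leq_trans xk; rewrite ltnS; apply/proper_card/properP; split=> //.
  by exists i'; rewrite inE // !mxE negbK xti' eqxx.
apply: (complementary_optimal (y := y)) => //; last exact: fintype.subset_trans sub xy.
case: xo => -[Ax _] _; split=> [|j]; last by rewrite !mxE.
by rewrite mulmxDr -scalemxAr Az scaler0 addr0.
Qed.

(* Moving a dual point along a direction orthogonal to the tight columns, until
   one more constraint becomes tight, eventually makes the tight columns span;
   this and [minimal_support] replace the simplex method. *)
Lemma maximal_tight y : \rank A = m -> (forall i, 0 <= dual_slack y i) ->
  exists y', [/\ forall i, 0 <= dual_slack y' i, tight y \subset tight y' &
    col_spanning A (tight y')].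
Proof.
move=> rA; have [k] := ubnP #|~: tight y|; elim: k y => // k IH y yk y0.
have [sy|] := pselect (col_spanning A (tight y)); first by exists y.
move/existsNP => [z /not_implyP [zy z0]].
have mulN u i : (A^T *m - u) i 0 = - (A^T *m u) i 0 by rewrite mulmxN [LHS]mxE.
(* [A^T *m z] is nonzero because [A] has full row rank, so [z] or [- z] gives a positive entry. *)
wlog [i zi] : z zy z0 / exists i, 0 < (A^T *m z) i 0.
  move=> wl; have [[i zi]|/forallNP zp] := pselect (exists i, 0 < (A^T *m z) i 0).
    by apply: (wl z) => //; exists i.
  apply: (wl (- z)).
  - by move=> i /zy; rewrite mulN => ->; rewrite oppr0.
  - by move/eqP; rewrite oppr_eq0 => /eqP.
  - apply: contrapT => /forallNP zn; apply: z0; apply: trmx_inj; rewrite linear0.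
    apply: (row_free_inj (A := A)); first by rewrite /row_free rA.
    apply: trmx_inj; rewrite mul0mx linear0 trmx_mul trmxK.
    apply/colP => i; rewrite [RHS]mxE.
    apply/eqP; rewrite eq_le; move: (zp i) (zn i); rewrite mulN oppr_gt0.
    by move=> /negP; rewrite -leNgt => -> /negP; rewrite -leNgt.
have dsD t j : dual_slack (y + t *: z) j = dual_slack y j + t * - (A^T *m z) j 0.
  by rewrite /dual_slack mulmxDr -scalemxAr !mxE; ring.
have [||t [t0 yt [i' yi' yti']]] := @ratio_test R _ (dual_slack y)
    (fun j => - (A^T *m z) j 0) y0 _ _.
- by move=> j yj; rewrite zy ?oppr0 // inE yj eqxx.
- by exists i; rewrite oppr_lt0.
have sub : tight y \subset tight (y + t *: z).
  apply/fintype.subsetP => j jy; rewrite inE dsD zy //.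
  by move: jy; rewrite inE => /eqP ->; rewrite oppr0 mulr0 addr0.
have [||y' [y'0 sub' sy']] := IH (y + t *: z).
- rewrite -ltnS; apply: leq_trans yk; rewrite ltnS; apply/proper_card/properP; split.
    by rewrite finset.setCS.
  by exists i'; rewrite !inE ?yi' // negbK dsD yti'.
- by move=> j; rewrite dsD.
by exists y'; split=> //; exact: fintype.subset_trans sub sub'.
Qed.

Lemma basic_of_tight f y : is_basis A f -> (forall j, f j \in tight y) ->
  y = lamB A c f.
Proof.
move=> bf fy; apply: lamB_unique => // j.
by have := fy j; rewrite inE subr_eq0 => /eqP.
Qed.

Lemma dual_feasible_slack f : dual_feasible A c f <->
  forall i, 0 <= dual_slack (lamB A c f) i.
Proof. by split=> h i; move: (h i); rewrite subr_ge0. Qed.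

Lemma supp_xB_tight f v : is_basis A f -> supp (xB A f v) \subset tight (lamB A c f).
Proof.
move=> bf; apply/fintype.subsetP => i; rewrite !inE.
have [[j <-]|/forallNP h] := pselect (exists j, f j = i).
  by rewrite /dual_slack lamB_tight // subrr.
by rewrite xB_expand expand_off ?eqxx // => j; apply/eqP/h.
Qed.

Lemma xB_optimal f beta : is_basis A f -> dual_feasible A c f ->
  (forall i, 0 <= xB A f beta i 0) -> lp_optimal A c beta (xB A f beta).
Proof.
move=> bf /dual_feasible_slack df f0.
apply: complementary_optimal df _; last exact: supp_xB_tight.
by split=> //; exact: mulmx_xB.
Qed.

(** Solvability becomes a finite disjunction of sign conditions, which serves both the analysis near
    [b] and the measurability of the solvability event. *)
Theorem optimal_basis beta : \rank A = m -> has_optimal A c beta <->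
  exists f, [/\ is_basis A f, dual_feasible A c f & forall i, 0 <= xB A f beta i 0].
Proof.
move=> rA; split=> [[x0 /minimal_support [x xo ix]]|[f [bf df f0]]]; last first.
  by exists (xB A f beta); exact: xB_optimal.
have [y0 y00 xy0] := optimal_dual xo.
have [y [y_ge0 y0y sy]] := maximal_tight rA y00.
(* The basis lies between the support of [x], which makes [x] its basic solution, and the tight set
   of [y], which makes [y] its dual solution. *)
have [f [bf xf fy]] := extend_to_basis (fintype.subset_trans xy0 y0y) ix sy.
have [[Ax x_ge0] _] := xo.
have xE : x = xB A f beta.
  apply: xB_unique => // i fi; apply/eqP/negPn/negP => xi.
  by have [|j /eqP] := xf i; [rewrite inE|rewrite (negbTE (fi j))].
exists f; split; rewrite -?xE //.
by apply/dual_feasible_slack => i; rewrite -(basic_of_tight bf fy).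
Qed.

End duality.

(** * Linear programs near a program with a unique optimum *)

Lemma sum_continuous (R : realType) (T : topologicalType) (V : normedModType R) n
    (F : 'I_n -> T -> V) :
  (forall i, continuous (F i)) -> continuous (fun x => \sum_i F i x).
Proof.
elim: n F => [|n IH] F cF x.
  rewrite (_ : (fun x => _) = cst 0); first exact: cvg_cst.
  by apply/funext => y; rewrite big_ord0.
rewrite (_ : (fun x => _) = (fun x => F ord0 x + \sum_i F (lift ord0 i) x)); last first.
  by apply/funext => y; rewrite big_ord_recl.
by apply: cvgD; [exact: cF|apply: (IH (fun i => F (lift ord0 i))) => i; exact: cF].
Qed.

Lemma linear_cV_continuous (R : realType) (V : normedModType R) n
    (g : {linear 'cV[R]_n -> V}) : continuous g.
Proof.
have -> : g = (fun v : 'cV[R]_n => \sum_i v i 0 *: g (delta_mx i 0)) :> (_ -> _).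
  apply/funext => v; rewrite {1}(matrix_sum_delta v) linear_sum; apply: eq_bigr => i _.
  by rewrite big_ord1 linearZ.
apply: sum_continuous => i v.
have h := @coord_continuous R n 1 i 0 v.
exact: cvgZr_tmp h.
Qed.

Section xB_linear.
Variables (R : realType) (m d : nat) (A : 'M[R]_(m, d)) (f : {ffun 'I_m -> 'I_d}).

Lemma xB_is_linear : linear (xB A f).
Proof.
move=> t u v; apply/colP => i; rewrite !mxE.
case: pickP => [j _|_]; last by rewrite mulr0 addr0.
by rewrite mulmxDr -scalemxAr !mxE.
Qed.

HB.instance Definition _ := GRing.isLinear.Build R 'cV[R]_m 'cV[R]_d _ (xB A f) xB_is_linear.

Lemma xB_continuous : continuous (xB A f).
Proof. exact: linear_cV_continuous. Qed.
End xB_linear.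

Section unique_optimum.
Variables (R : realType) (m d : nat) (A : 'M[R]_(m, d)) (c : 'cV[R]_d).
Variables (b : 'cV[R]_m) (xb : 'cV[R]_d) (Ks : seq {ffun 'I_m -> 'I_d}).
Hypothesis rA : \rank A = m.
Hypothesis KsP : forall f, f \in Ks <->
  [/\ is_basis A f, dual_feasible A c f & forall i, 0 <= xB A f b i 0].
Hypothesis xb_opt : lp_optimal A c b xb.
Hypothesis xb_uniq : forall x, lp_optimal A c b x -> x = xb.
Hypothesis lamB_inj : {in Ks &, injective (lamB A c)}.

Lemma Ks_basis f : f \in Ks -> is_basis A f. Proof. by move/KsP => []. Qed.

Lemma Ks_slack_ge0 f i : f \in Ks -> 0 <= dual_slack A c (lamB A c f) i.
Proof. by move/KsP => [_ /dual_feasible_slack]. Qed.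

Lemma xb_ge0 i : 0 <= xb i 0. Proof. by case: xb_opt => -[]. Qed.

Lemma xB_base f : f \in Ks -> xB A f b = xb.
Proof. by move=> /KsP[? ? ?]; apply/xb_uniq/xB_optimal. Qed.

(* A nonbasic tight constraint [i] would be part of another basis with the same
   dual solution: by uniqueness of the primal optimum, the columns of the support
   of [xb] together with column [i] are independent. *)
Lemma tight_basic f i : f \in Ks -> i \in tight A c (lamB A c f) ->
  exists j, f j = i.
Proof.
move=> fK iT; set T := tight A c (lamB A c f) in iT *.
apply: contrapT => /forallNP nbi.
have bf := Ks_basis fK.
have ST : i |: supp xb \subset T.
  by rewrite finset.subUset finset.sub1set iT -(xB_base fK) supp_xB_tight.
have fT j : f j \in T by rewrite inE /dual_slack lamB_tight // subrr.
have iS : col_indep A (i |: supp xb).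
  (* A small step from [xb] along [z] stays feasible and complementary to [lamB A c f], so it is
     optimal and gives [xb] again. *)
  have pos (z : 'cV[R]_d) : 0 <= z i 0 -> A *m z = 0 ->
      (forall k, k \notin i |: supp xb -> z k 0 = 0) -> z = 0.
    move=> zi Az zS; have [||t t0 xt] := @feasible_step _ _ (xb^~ 0) (z^~ 0).
    - exact: xb_ge0.
    - move=> k xk; have [->//|ki] := eqVneq k i.
      by rewrite zS // !inE xk eqxx orbF.
    have : xb + t *: z = xb.
      apply/xb_uniq/(complementary_optimal (y := lamB A c f)).
      - split=> [|k]; last by rewrite !mxE.
        by rewrite mulmxDr -scalemxAr Az scaler0 addr0; case: xb_opt => -[].
      - by move=> k; exact: Ks_slack_ge0.
      - apply: fintype.subset_trans ST; apply/fintype.subsetP => k.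
        rewrite [k \in supp _]inE; apply: contraNT => kS; rewrite !mxE zS // mulr0 addr0.
        by move: kS; rewrite !inE negb_or negbK => /andP[].
    move/(congr1 (fun x => x - xb)); rewrite addrAC subrr add0r => /eqP.
    by rewrite scaler_eq0 gt_eqF //= => /eqP.
  move=> z Az zS; have [zi|zi] := leP 0 (z i 0); first exact: pos.
  apply/eqP; rewrite -oppr_eq0; apply/eqP/pos; rewrite ?mulmxN ?Az ?oppr0 //.
    by rewrite mxE oppr_ge0 ltW.
  by move=> k /zS zk; rewrite mxE zk oppr0.
(* The new basis contains [i] and has the dual solution of [f]; injectivity of [lamB] on [Ks] then
   forces it to be [f]. *)
have [g [bg Sg gT]] := extend_to_basis ST iS (basis_spanning bf fT).
have lE : lamB A c f = lamB A c g := basic_of_tight bg gT.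
have gK : g \in Ks.
  apply/KsP; split=> //.
    by apply/dual_feasible_slack => k; rewrite -lE; exact: Ks_slack_ge0.
  suff <- : xb = xB A g b by exact: xb_ge0.
  apply: xB_unique => // [|k gk]; first by case: xb_opt => -[].
  apply/eqP/negPn/negP => xk; have [|j /eqP] := Sg k.
    by rewrite !inE xk orbT.
  by rewrite (negbTE (gk j)).
have [|j ij] := Sg i; first by rewrite !inE eqxx.
by apply: (nbi j); rewrite (lamB_inj fK gK lE).
Qed.

(** Complementarity with [lamB A c f] confines the support of [x] to the tight set, whose indices
    are basic by [tight_basic]; then [A *m x = beta] determines [x]. *)
Lemma optimal_unique f beta x : f \in Ks -> (forall i, 0 <= xB A f beta i 0) ->
  lp_optimal A c beta x -> x = xB A f beta.
Proof.
move=> fK f0 xo; have bf := Ks_basis fK.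
apply: xB_unique => //; first by case: xo => -[].
move=> i fi; apply/eqP/negPn/negP => xi.
have /fintype.subsetP/(_ i) : supp x \subset tight A c (lamB A c f).
  apply: optimal_complementary xo; last exact: (supp_xB_tight c beta bf).
    by split=> //; exact: mulmx_xB.
  by move=> k; exact: Ks_slack_ge0.
by rewrite inE => /(_ xi)/(tight_basic fK) [j /eqP]; rewrite (negbTE (fi j)).
Qed.

(** A dual feasible basis outside [Ks] has a negative coordinate at [b], which stays negative
    nearby; there are finitely many bases. *)
Lemma near_Ks : \forall beta \near b, forall f,
  is_basis A f -> dual_feasible A c f -> (forall i, 0 <= xB A f beta i 0) -> f \in Ks.
Proof.
apply: (@filter_forall _ _ (fun f => [set beta | is_basis A f ->
  dual_feasible A c f -> (forall i, 0 <= xB A f beta i 0) -> f \in Ks]) (nbhs b)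
  (nbhs_filter b)) => f.
have [fK|fK] := boolP (f \in Ks); first by near=> beta.
have [bf|nbf] := pselect (is_basis A f); last by near=> beta.
have [df|ndf] := pselect (dual_feasible A c f); last by near=> beta.
have [i fi] : exists i, xB A f b i 0 < 0.
  apply: contrapT => /forallNP h; move/negP: fK; apply; apply/KsP; split=> // i.
  by rewrite leNgt; apply/negP/h.
have : \forall beta \near b, xB A f beta i 0 < 0.
  have cf := @continuous_comp _ _ _ (xB A f) (fun x : 'cV[R]_d => x i 0) b
    (@xB_continuous R m d A f b) (@coord_continuous R d 1 i 0 _).
  exact: cvgr_lt cf _ fi.
by apply: filterS => beta fb _ _ /(_ i); rewrite leNgt fb.
Unshelve. all: by end_near. Qed.

Lemma xB_coord f v j : is_basis A f ->
  xB A f v (f j) 0 = (invmx (colsub f A) *m v) j 0.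
Proof. by move=> bf; rewrite xB_expand expandE //; exact: basis_inj bf. Qed.

(** Coordinates at which [xb] is positive tolerate a small step in any direction; at the others the
    sign comes from [Hcone], or the coordinate is nonbasic and stays 0. *)
Lemma Hcone_step f v : f \in Ks -> Hcone A xb f v ->
  exists2 t, 0 < t & forall s, 0 < s <= t -> forall i, 0 <= xB A f (b + s *: v) i 0.
Proof.
move=> fK fv; have bf := Ks_basis fK.
have [||t t0 xt] := @feasible_step _ _ (xb^~ 0) ((xB A f v)^~ 0).
- exact: xb_ge0.
- move=> i xi; have [[j fj]|/forallNP h] := pselect (exists j, f j = i).
    by rewrite -fj xB_coord //; apply: fv; rewrite fj xi ltxx.
  by rewrite xB_expand expand_off // => j; apply/eqP/h.
exists t => // s /andP[s0 st] i; rewrite linearD linearZ /= xB_base // !mxE.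
have := xt i; have := xb_ge0 i; rewrite [xB A f v i 0]mxE.
set u := xb i 0; set w := (X in _ + _ * X) => u0 uw.
have [w0|w0] := leP 0 w; first by rewrite addr_ge0 // mulr_ge0 // ltW.
by apply: le_trans uw _; rewrite lerD2l ler_wnM2r // ltW.
Qed.

(** For a small step [tau] both basic solutions at [b + tau *: v] are feasible, hence optimal, hence
    equal; it remains to subtract [xb] and divide by [tau]. *)
Lemma Hcone_agree f g v : f \in Ks -> g \in Ks ->
  Hcone A xb f v -> Hcone A xb g v -> xB A f v = xB A g v.
Proof.
move=> fK gK /(Hcone_step fK)[t t0 ft] /(Hcone_step gK)[s s0 gs].
pose tau := Num.min t s.
have tau0 : 0 < tau by rewrite lt_min t0 s0.
have [bf df _] := (KsP f).1 fK.
have /(optimal_unique gK) : lp_optimal A c (b + tau *: v) (xB A f (b + tau *: v)).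
  by apply: xB_optimal => //; apply: ft; rewrite tau0 ge_min lexx.
move=> /(_ (gs tau _)); rewrite tau0 ge_min lexx orbT => /(_ isT).
rewrite !linearD !linearZ /= !xB_base // => /addrI /(scalerI _); apply.
by rewrite gt_eqF.
Qed.

(** Only the first cone containing [v] contributes, and its basic solution agrees with that of [f]
    by [Hcone_agree]. *)
Lemma lim_vecE f v : f \in Ks -> Hcone A xb f v -> lim_vec A xb Ks v = xB A f v.
Proof.
move=> fK fv.
pose H (k : 'I_(size Ks)) := Hcone A xb (tnth (in_tuple Ks) k).
have exk : exists k : 'I_(size Ks), `[< H k v >].
  have /tnthP[k fE] : f \in in_tuple Ks by [].
  by exists k; apply/asboolP; rewrite /H -fE.
have [k0 k0v] := exk.
case: (@arg_minnP _ k0 (fun k => `[< H k v >]) val k0v) => k /asboolP kv kmin.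
have kK : tnth (in_tuple Ks) k \in Ks by exact: mem_tnth.
rewrite /lim_vec (bigD1 k) //= big1 ?addr0 => [|l lk].
  rewrite indicE mem_set ?scale1r; first exact: Hcone_agree.
  split=> // -[l /= lk /asboolP lv].
  by have := kmin l lv; rewrite leqNgt lk.
rewrite indicE memNset ?scale0r // => -[/= lv nl].
have /kmin kl : `[< H l v >] by apply/asboolP.
by apply: nl; exists k => //=; rewrite ltn_neqAle kl andbT eq_sym.
Qed.

(** An optimal basis at [beta] belongs to [Ks]. Where [xb] vanishes, its feasibility at [beta] is
    the sign condition of the cone, which is invariant under positive scaling. The resulting
    identity is exact, not asymptotic. *)
Lemma near_lim_vec : \forall beta \near b, forall r x, 0 < r ->
  has_optimal A c beta -> lp_optimal A c beta x ->
  (exists2 f, f \in Ks & Hcone A xb f (r *: (beta - b))) /\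
  r *: (x - xb) = lim_vec A xb Ks (r *: (beta - b)).
Proof.
apply: filterS near_Ks => beta bK r x r0 /(optimal_basis _ _ rA) [f [bf df f0]] xo.
have fK : f \in Ks by exact: bK.
have fE : xB A f (r *: (beta - b)) = r *: (xB A f beta - xb).
  by rewrite linearZ linearB /= xB_base.
have fH : Hcone A xb f (r *: (beta - b)).
  move=> j /negP; rewrite -leNgt => xj; rewrite -xB_coord // fE.
  have -> : (r *: (xB A f beta - xb)) (f j) 0 = r * (xB A f beta (f j) 0 - xb (f j) 0).
    by rewrite !mxE.
  have -> : xb (f j) 0 = 0 by apply/eqP; rewrite eq_le xj xb_ge0.
  by rewrite subr0 mulr_ge0 // ltW.
split; first by exists f.
by rewrite (lim_vecE fK fH) fE (optimal_unique fK f0 xo).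
Qed.

Lemma closed_Hcone f : closed (Hcone A xb f).
Proof.
have -> : Hcone A xb f = \bigcap_(j in [set j | ~ 0 < xb (f j) 0])
    ((fun v : 'cV[R]_m => (invmx (colsub f A) *m v) j 0) @^-1` [set x | 0 <= x]).
  by apply/seteqP; split=> v vH j xj; exact: vH.
apply: closed_bigI => j _; apply: preimage_closed; last exact: closed_ge.
move=> v _; apply: (@continuous_comp _ _ _ (mulmx (invmx (colsub f A)))
  (fun x : 'cV[R]_m => x j 0)); first exact: linear_cV_continuous.
exact: coord_continuous.
Qed.

Definition cone_union (s : seq {ffun 'I_m -> 'I_d}) : set 'cV[R]_m :=
  [set v | exists2 f, f \in s & Hcone A xb f v].

(** On each cone [lim_vec] is the linear map of one basis, so pasting over finitely many closed sets
    gives continuity despite the indicators. *)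
Lemma lim_vec_within (s : seq {ffun 'I_m -> 'I_d}) : {subset s <= Ks} ->
  closed (cone_union s) /\ {within cone_union s, continuous (lim_vec A xb Ks)}.
Proof.
elim: s => [|f s IH] sK.
  have -> : cone_union [::] = set0 by rewrite -subset0 => v [].
  by split; [exact: closed0|exact: continuous_subspace0].
have fK : f \in Ks by apply: sK; rewrite mem_head.
have [|cs ws] := IH; first by move=> g gs; apply: sK; rewrite inE gs orbT.
have -> : cone_union (f :: s) = Hcone A xb f `|` cone_union s.
  apply/seteqP; split=> v.
    by move=> [g]; rewrite inE => /predU1P[->|gs] gv; [left|right; exists g].
  by move=> [fv|[g gs gv]]; [exists f; rewrite ?mem_head|exists g; rewrite // inE gs orbT].
split; first by apply: closedU => //; exact: closed_Hcone.
apply: withinU_continuous => //; first exact: closed_Hcone.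
apply: (@subspace_eq_continuous _ _ _ (xB A f)).
  by move=> v /set_mem fv; exact/esym/lim_vecE.
by apply: continuous_subspaceT; exact: xB_continuous.
Qed.

End unique_optimum.

(** * Weak convergence *)

Section bounded_integrals.
Variables (R : realType) (dT : measure_display) (T : measurableType dT).
Variable P : probability T R.
Local Notation EP f := (Rintegral P setT f).

Lemma bounded_integrable (f : T -> R) M : measurable_fun setT f ->
  (forall w, `|f w| <= M) -> P.-integrable setT (EFin \o f).
Proof.
move=> mf fM; apply: measurable_bounded_integrable => //.
  by rewrite [X in (X < _)%E](probability_setT P) ltry.
exists M; split; first exact: num_real.
by move=> x Mx w _; apply: le_trans (fM w) (ltW Mx).
Qed.

Lemma EFin_Rintegral (f : T -> R) M : measurable_fun setT f ->
  (forall w, `|f w| <= M) -> (\int[P]_w (f w)%:E)%E = (EP f)%:E.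
Proof.
move=> mf fM; rewrite /Rintegral fineK //.
by apply: integrable_fin_num => //; exact: bounded_integrable fM.
Qed.

Lemma EFin_fineP B : measurable B -> P B = (fine (P B))%:E.
Proof. by move=> mB; rewrite fineK // fin_num_measure. Qed.

Lemma Rintegral_indic B : measurable B -> EP \1_B = fine (P B).
Proof. by move=> mB; rewrite /Rintegral integral_indic // setIT. Qed.

Lemma indic_le1 (B : set T) w : `|\1_B w : R| <= 1.
Proof. by rewrite indicE; case: (_ \in _); rewrite ?normr1 ?normr0. Qed.

Lemma indic_integrable B : measurable B -> P.-integrable setT (EFin \o \1_B).
Proof. by move=> mB; apply: bounded_integrable (indic_le1 B); exact: measurable_indic. Qed.

Lemma Rintegral_replace (f g : T -> R) M B :
  measurable_fun setT f -> measurable_fun setT g -> measurable B ->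
  (forall w, `|f w| <= M) -> (forall w, `|g w| <= M) ->
  (forall w, ~ B w -> f w = g w) ->
  `|EP f - EP g| <= (M *+ 2) * fine (P B).
Proof.
move=> mf mg mB fM gM fg.
have iF := bounded_integrable mf fM; have iG := bounded_integrable mg gM.
have fgM w : `|(f \- g) w| <= M *+ 2.
  by rewrite mulr2n; apply: le_trans (ler_normB _ _) _; exact: lerD.
have mfg : measurable_fun setT (f \- g) by exact: measurable_funB.
rewrite -RintegralB //; apply: le_trans (le_normr_Rintegral _ _) _ => //.
  exact: bounded_integrable fgM.
rewrite -Rintegral_indic // -RintegralZl //; last exact: indic_integrable.
apply: le_Rintegral => //.
- apply: (@bounded_integrable _ (M *+ 2)); first exact: measurableT_comp.
  by move=> w; rewrite /= normr_id; exact: fgM.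
- apply: (@bounded_integrable _ `|M *+ 2|).
    by apply: measurable_funM => //; exact: measurable_indic.
  by move=> w; rewrite normrM ler_piMr // indic_le1.
move=> w _; have [Bw|nBw] := pselect (B w).
  by rewrite mem_set // mulr1; exact: fgM.
by rewrite memNset // mulr0 /= fg // subrr normr0.
Qed.

End bounded_integrals.

(** * Borel measurability of random vectors *)

Section rvec.
Variables (R : realType) (dT : measure_display) (T : measurableType dT).

(** An open set is the countable union of the boxes with rational centre and radius [n.+1%:R^-1]
    that it contains. *)
Lemma open_preimage_measurable k (X : T -> 'cV[R]_k) (U : set 'cV[R]_k) :
  rvec_measurable X -> open U -> measurable (X @^-1` U).
Proof.
move=> mX oU.
pose box (p : 'cV[rat]_k * nat) : set 'cV[R]_k :=
  [set v | forall i, ball (ratr (p.1 i 0) : R) (p.2.+1%:R^-1) (v i 0)].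
pose F p := if `[< box p `<=` U >] then X @^-1` box p else set0.
have -> : X @^-1` U = \bigcup_p F p.
  apply/seteqP; split=> w /=; last first.
    by move=> [p _]; rewrite /F; case: asboolP => // pU /pU.
  move=> Uw; have /nbhs_ballP[e /= e0 eU] : nbhs (X w) U by exact: open_nbhs_nbhs.
  (* One half of [e] bounds the distance from [X w] to the centre, the other that from the centre to
     a point of the box. *)
  have e20 : 0 < e / 2 by rewrite divr_gt0.
  have [n _ /(_ n (leqnn n)) /= en] := near_infty_natSinv_lt (PosNum e20).
  have n0 : 0 < n.+1%:R^-1 :> R by rewrite invr_gt0.
  have hq i : exists q : rat, `|(ratr q : R) - X w i 0| < n.+1%:R^-1.
    have [q] := rat_in_itvoo (ltr_pwDr n0 (lexx (X w i 0))).
    rewrite in_itv /= => /andP[q1 q2]; exists q.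
    by rewrite gtr0_norm ?subr_gt0 // ltrBlDl.
  have [q qX] := choice hq; exists (\col_i q i, n) => //.
  rewrite /F; case: asboolP => [_|nU] /=.
    by move=> i; rewrite /= mxE; exact: qX.
  exfalso; apply: nU => v /= vq; apply: eU; split=> // i j; rewrite ord1.
  have := vq i; rewrite /= mxE /ball /= => vi; have qi := qX i.
  rewrite -(subrK (ratr (q i)) (X w i 0)) -addrA.
  apply: le_lt_trans (ler_normD _ _) _; rewrite [e]splitr.
  by apply: ltrD; [rewrite distrC; exact: lt_trans en|exact: lt_trans en].
apply: countable_bigcupT_measurable => // p; rewrite /F; case: asboolP => // _.
have -> : X @^-1` box p = \bigcap_(i in setT)
    (fun w => X w i 0) @^-1` ball (ratr (p.1 i 0) : R) (p.2.+1%:R^-1).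
  by apply/seteqP; split=> w h i; [move=> _; exact: h|exact: (h i I)].
apply: fin_bigcap_measurable => // i _; rewrite -[X in measurable X]setTI.
by apply: mX => //; exact: measurable_ball.
Qed.

Lemma continuous_rvec_measurable k (X : T -> 'cV[R]_k) (g : 'cV[R]_k -> R) :
  rvec_measurable X -> continuous g -> measurable_fun setT (g \o X).
Proof.
move=> mX cg; apply: (measurability _ (RGenOInfty.measurableE R)) => //.
move=> _ [_ [x ->] <-]; rewrite setTI.
apply: (@open_preimage_measurable _ X (g @^-1` `]x, +oo[)) => //.
by apply: open_comp => // v _; exact: cg.
Qed.

Lemma closed_preimage_measurable k (X : T -> 'cV[R]_k) (C : set 'cV[R]_k) :
  rvec_measurable X -> closed C -> measurable (X @^-1` C).
Proof.
move=> mX cC; rewrite -[X in measurable X]setCK; apply: measurableC.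
exact: (open_preimage_measurable mX (closed_openC cC)).
Qed.

Lemma rvec_measurable_affine k (X : T -> 'cV[R]_k) (r : R) (v : 'cV[R]_k) :
  rvec_measurable X -> rvec_measurable (fun w => r *: (X w - v)).
Proof.
move=> mX i; under eq_fun do rewrite !mxE.
by apply: measurable_funM => //; apply: measurable_funB.
Qed.
End rvec.

(** * Convergence in distribution through real-valued integrals *)

Section convergence_in_distribution.
Variables (R : realType) (dO : measure_display) (O : measurableType dO).
Variables (P : probability O R).
Variables (dO' : measure_display) (O' : measurableType dO') (Q : probability O' R).
Local Notation EP f := (Rintegral P setT f).
Local Notation EQ f := (Rintegral Q setT f).

Lemma conv_distP k (X : nat -> O -> 'cV[R]_k) (Y : O' -> 'cV[R]_k) :
  (forall n, rvec_measurable (X n)) -> rvec_measurable Y ->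
  conv_dist P Q X Y <-> forall f : 'cV[R]_k -> R, continuous f ->
    (exists M : R, forall v, `|f v| <= M) ->
    (fun n => EP (f \o X n)) @ \oo --> EQ (f \o Y).
Proof.
move=> mX mY; split=> h f cf [M fM].
  have := h f cf (ex_intro _ M fM).
  rewrite (EFin_Rintegral Q (continuous_rvec_measurable mY cf) (fun w => fM (Y w))).
  under eq_fun do rewrite (EFin_Rintegral P (continuous_rvec_measurable (mX _) cf)
    (fun w => fM (X _ w))).
  by move/fine_cvgP => [].
rewrite (EFin_Rintegral Q (continuous_rvec_measurable mY cf) (fun w => fM (Y w))).
under eq_fun do rewrite (EFin_Rintegral P (continuous_rvec_measurable (mX _) cf)
  (fun w => fM (X _ w))).
by apply: cvg_EFin; [near=> n|apply: h => //; exists M].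
Unshelve. all: by end_near. Qed.

Lemma cvg_Rintegral_replace (f g : nat -> O -> R) (M : R) (B : nat -> set O) (l : R) :
  (forall n, measurable_fun setT (f n)) -> (forall n, measurable_fun setT (g n)) ->
  (forall n, measurable (B n)) ->
  (forall n w, `|f n w| <= M) -> (forall n w, `|g n w| <= M) ->
  (\forall n \near \oo, forall w, ~ B n w -> f n w = g n w) ->
  (fun n => fine (P (B n))) @ \oo --> 0 ->
  (fun n => EP (g n)) @ \oo --> l -> (fun n => EP (f n)) @ \oo --> l.
Proof.
move=> mf mg mB fM gM fg B0 gl.
have d0 : (fun n => EP (f n) - EP (g n)) @ \oo --> 0.
  apply/norm_cvg0P; apply: (@squeeze_cvgr _ _ _ _ (cst 0) (fun n => M *+ 2 * fine (P (B n)))).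
  - near=> n; rewrite normr_ge0 /=; apply: Rintegral_replace => //.
    by near: n.
  - exact: cvg_cst.
  - have : (fun n => M *+ 2 * fine (P (B n))) @ \oo --> M *+ 2 * 0.
      by apply: cvgM => //; exact: cvg_cst.
    by rewrite mulr0.
have -> : (fun n => EP (f n)) = (fun n => EP (g n) + (EP (f n) - EP (g n))).
  by apply/funext => n; rewrite addrC subrK.
by rewrite -(addr0 l); exact: cvgD.
Unshelve. all: by end_near. Qed.

Lemma conv_dist_ae_eq k (X : nat -> O -> 'cV[R]_k) (Y Y' : O' -> 'cV[R]_k) :
  rvec_measurable Y -> rvec_measurable Y' -> {ae Q, forall w, Y w = Y' w} ->
  conv_dist P Q X Y -> conv_dist P Q X Y'.
Proof.
move=> mY mY' YY' h f cf bf.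
rewrite (@ae_eq_integral _ _ _ Q setT (fun w => (f (Y w))%:E)) //; first exact: h.
- by apply/measurable_EFinP; exact: continuous_rvec_measurable.
- by apply/measurable_EFinP; exact: continuous_rvec_measurable.
by apply: filterS YY' => w /= -> _.
Qed.

End convergence_in_distribution.

Lemma closed_norm_ge (R : realType) (V : normedModType R) (x : R) :
  closed [set v : V | x <= `|v|].
Proof.
pose nV (v : V) : R := `|v|.
by apply: (preimage_closed (f := nV) _ (@closed_ge _ x)) => v _; exact: norm_continuous.
Qed.

(** * Tightness and a mapping theorem for maps continuous on a closed set *)

Section mapping.
Variables (R : realType) (dO : measure_display) (O : measurableType dO).
Variables (P : probability O R).
Variables (dO' : measure_display) (O' : measurableType dO') (Q : probability O' R).
Local Notation EP f := (Rintegral P setT f).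
Local Notation EQ f := (Rintegral Q setT f).

Lemma continuous_min (T : topologicalType) (f g : T -> R) :
  continuous f -> continuous g -> continuous (fun v => Num.min (f v) (g v)).
Proof.
move=> cf cg v; rewrite (_ : (fun v => _) = fun v => (f v + g v - `|f v - g v|) / 2).
  by apply: cvgM; [|exact: cvg_cst]; apply: cvgB; [apply: cvgD; [exact: cf|exact: cg]|];
     apply: cvg_norm; apply: cvgB; [exact: cf|exact: cg].
by apply/funext => w; rewrite minr_absE.
Qed.

Lemma continuous_max (T : topologicalType) (f g : T -> R) :
  continuous f -> continuous g -> continuous (fun v => Num.max (f v) (g v)).
Proof.
move=> cf cg v; rewrite (_ : (fun v => _) = fun v => (f v + g v + `|f v - g v|) / 2).
  by apply: cvgM; [|exact: cvg_cst]; apply: cvgD; [apply: cvgD; [exact: cf|exact: cg]|];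
     apply: cvg_norm; apply: cvgB; [exact: cf|exact: cg].
by apply/funext => w; rewrite maxr_absE.
Qed.

Lemma norm_min1_le1 (x : R) : 0 <= x -> `|Num.min 1 x| <= 1.
Proof. by move=> x0; rewrite ger0_norm ?le_min ?ler01 // ge_min lexx. Qed.

(** The limit has small mass far out, which passes to [X n] through a continuous cutoff, and
    [eps * r n] eventually exceeds any fixed bound. *)
Lemma conv_dist_small k (X : nat -> O -> 'cV[R]_k) (Y : O' -> 'cV[R]_k)
    (r : nat -> R) eps :
  (forall n, rvec_measurable (X n)) -> rvec_measurable Y -> conv_dist P Q X Y ->
  r @ \oo --> +oo -> 0 < eps ->
  (fun n => fine (P [set w | eps * r n <= `|X n w|])) @ \oo --> 0.
Proof.
move=> mX mY XY roo eps0; apply/cvgrPdist_lt => e e0.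
pose nY (v : 'cV[R]_k) : R := `|v|.
have cn : continuous nY by exact: norm_continuous.
pose F (n : nat) : set O' := [set w | n%:R <= nY (Y w)].
have mge d (T : measurableType d) (W : T -> 'cV[R]_k) (x : R) :
    rvec_measurable W -> measurable [set w | x <= nY (W w)].
  move=> mW; apply: (@closed_preimage_measurable _ _ _ _ W [set v | x <= nY v]) => //.
  exact: closed_norm_ge.
have [N FN] : exists N, fine (Q (F N)) < e.
  have F0 : \bigcap_n F n = set0.
    rewrite -subset0 => w /= Fw.
    have := Fw (Num.bound (nY (Y w))) I; rewrite /F /= leNgt => /negP; apply.
    exact/archi_boundP/normr_ge0.
  have mF n : measurable (F n) by exact: mge.
  have := @nonincreasing_cvg_mu _ _ _ Q F; rewrite F0 measure0 => h.
  have {h} : (fun n => fine (Q (F n))) @ \oo --> 0.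
    apply: fine_cvg; apply: h => //.
      exact: (le_lt_trans (probability_le1 Q (mF 0%N)) (ltry _)).
    move=> n p np; apply/subsetPset => w /=; apply: le_trans.
    by rewrite ler_nat.
  move=> /cvgrPdist_lt/(_ e e0)[N _ /(_ N (leqnn N))] /=; rewrite sub0r normrN => h.
  by exists N; apply: le_lt_trans h; exact: ler_norm.
(* This cutoff lies between the indicators of norm at least [N + 1] and of norm at least [N]. *)
pose h (v : 'cV[R]_k) := Num.min 1 (Num.max 0 (nY v - N%:R)).
have ch : continuous h.
  apply: continuous_min; first exact: cst_continuous.
  apply: continuous_max; first exact: cst_continuous.
  by move=> v; exact: (cvgB (cn v) (cvg_cst _)).
have h0 v : 0 <= h v by rewrite le_min ler01 le_max lexx.
have h1 v : h v <= 1 by rewrite ge_min lexx.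
have hN v : `|h v| <= 1 by rewrite ger0_norm.
have ih := bounded_integrable _ (continuous_rvec_measurable _ ch) (fun w => hN _).
have /cvgr_lt/(_ e) : (fun n => EP (h \o X n)) @ \oo --> EQ (h \o Y).
  by apply: (conv_distP P Q mX mY).1 => //; exists 1.
have mFN : measurable (F N) by exact: mge.
have -> : EQ (h \o Y) < e.
  apply: le_lt_trans FN; rewrite -Rintegral_indic //; apply: le_Rintegral => //.
  - exact: ih.
  - exact: indic_integrable.
  move=> w _ /=; rewrite ?indicE; have [wF|wF] := pselect (F N w).
    by rewrite mem_set.
  rewrite memNset // /h max_l ?ge_min ?lexx ?orbT // subr_le0 leNgt.
  by apply/negP => /ltW.
move=> /(_ isT) hlt; have rN := (cvgryPge _).1 roo ((N%:R + 1) / eps).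
near=> n; have mBn : measurable [set w | eps * r n <= nY (X n w)] by exact: mge.
rewrite sub0r normrN ger0_norm ?fine_ge0 // -Rintegral_indic //.
apply: (@le_lt_trans _ _ (EP (h \o X n))); last by near: n.
apply: le_Rintegral => //; [exact: indic_integrable|exact: ih|].
move=> w _ /=; rewrite ?indicE; have [wB|wB] := pselect (eps * r n <= nY (X n w)).
  rewrite mem_set // le_min lexx /= le_max; apply/orP; right.
  rewrite lerBrDl; apply: le_trans wB.
  by rewrite mulrC -ler_pdivrMr //; near: n; exact: rN.
by rewrite memNset.
Unshelve. all: by end_near. Qed.

(* [Z n] is a function of [X n] up to events of vanishing probability, but that
   function is continuous only on the closed set [C] carrying the limit; Tietze's
   theorem provides a continuous replacement. *)
Lemma conv_dist_mapping k l (X : nat -> O -> 'cV[R]_k) (Y : O' -> 'cV[R]_k)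
    (Z : nat -> O -> 'cV[R]_l) (phi : 'cV[R]_k -> 'cV[R]_l) (psi : 'cV[R]_k -> R)
    (C : set 'cV[R]_k) (B : nat -> set O) :
  continuous psi -> (forall v, 0 <= psi v) -> (forall v, psi v = 0 <-> C v) ->
  closed C -> {within C, continuous phi} ->
  (forall n, rvec_measurable (X n)) -> rvec_measurable Y ->
  (forall n, rvec_measurable (Z n)) -> rvec_measurable (phi \o Y) ->
  (forall n, measurable (B n)) -> (fun n => fine (P (B n))) @ \oo --> 0 ->
  (\forall n \near \oo, forall w, ~ B n w -> C (X n w) /\ Z n w = phi (X n w)) ->
  conv_dist P Q X Y -> conv_dist P Q Z (phi \o Y).
Proof.
move=> cpsi psi0 psiC cC wphi mX mY mZ mphiY mB B0 BC XY.
(* The truncated gauge [Num.min 1 (psi v)] vanishes at [X n] off [B n], so its integrals tend to 0;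
   its integral at [Y] is therefore 0, and [psi] vanishes there almost surely. *)
have YC : {ae Q, forall w, C (Y w)}.
  pose g v := Num.min 1 (psi v).
  have cg : continuous g by apply: continuous_min => //; exact: cst_continuous.
  have g1 v : `|g v| <= 1 by exact: norm_min1_le1.
  have mg d (T : measurableType d) (W : T -> 'cV[R]_k) :
      rvec_measurable W -> measurable_fun setT (g \o W).
    by move=> mW; exact: continuous_rvec_measurable.
  have gl : (fun n => EP (g \o X n)) @ \oo --> EQ (g \o Y).
    by apply: (conv_distP P Q mX mY).1 => //; exists 1.
  have g0 : (fun n => EP (g \o X n)) @ \oo --> 0.
    apply: (@cvg_Rintegral_replace _ _ _ P (fun n => g \o X n) (fun=> cst 0) 1 B) => //.
    - by move=> n; exact: mg.
    - by move=> n w /=; exact: g1.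
    - by move=> n w /=; rewrite normr0.
    - apply: filterS BC => n h w /h[/psiC psiX _].
      by rewrite /= /g psiX min_r.
    - under eq_fun do rewrite /Rintegral integral0.
      exact: cvg_cst.
  have EQ0 : EQ (g \o Y) = 0 by exact: cvg_unique gl g0.
  have := ae_eq_integral_abs Q measurableT
    ((measurable_EFinP _ _).2 (mg _ _ Y mY)) => -[+ _].
  have -> : (\int[Q]_x `|((EFin \o (g \o Y)) x)| = 0)%E.
    rewrite -[RHS]/(0%:E) -EQ0 -(EFin_Rintegral Q (mg _ _ Y mY) (fun w => g1 (Y w))).
    apply: eq_integral => w _ /=; rewrite ger0_norm //.
    by rewrite le_min ler01 psi0.
  move=> /(_ erefl); apply: filterS => w /(_ I) [gw]; apply/psiC.
  apply/eqP; rewrite eq_le psi0 andbT leNgt; apply/negP => psiw.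
  by move/eqP: gw; rewrite gt_eqF // lt_min ltr01.
apply: (conv_distP P Q mZ mphiY).2 => f cf [M fM].
(* Adding 1 makes the bound positive, as the extension theorem requires. *)
have M0 : 0 < `|M| + 1 by rewrite ltr_wpDl.
have fM' v : `|f v| <= `|M| + 1.
  by apply: le_trans (fM v) _; apply: le_trans (ler_norm M) _; rewrite lerDl.
have wf : {within C, continuous (f \o phi)}.
  by move=> x; exact: (@continuous_comp _ _ _ (phi : subspace C -> _) f x (wphi x) (cf _)).
have [h [fh ch hM]] := continuous_bounded_extension (@pseudometric_normal R _) cC
  M0 wf (fun v _ => fM' (phi v)).
have -> : EQ (f \o (phi \o Y)) = EQ (h \o Y).
  rewrite /Rintegral; congr fine; apply: ae_eq_integral => //.
  - by apply/measurable_EFinP; exact: continuous_rvec_measurable.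
  - by apply/measurable_EFinP; exact: continuous_rvec_measurable.
  by apply: filterS YC => w Cw _ /=; rewrite -fh ?inE.
apply: (@cvg_Rintegral_replace _ _ _ P _ (fun n => h \o X n) (`|M| + 1) B) => //.
- by move=> n; exact: continuous_rvec_measurable.
- by move=> n; exact: continuous_rvec_measurable.
- by move=> n w /=.
- by move=> n w /=.
- by apply: filterS BC => n H w /H[CX ZX] /=; rewrite ZX -fh ?inE.
- by apply: (conv_distP P Q mX mY).1 => //; exists (`|M| + 1).
Qed.

End mapping.

(** * Hyperplanes are null sets *)

Section null_sets.
Variables (R : realType) (k : nat).

(** The finite family is padded to a sequence with the degenerate box at 0, whose volume is 0
    because [k] is positive. *)
Lemma lebesgue_null_fin (S : set 'cV[R]_k) : (0 < k)%N ->
  (forall eps : R, 0 < eps -> exists (T : finType) (lo hi : T -> 'cV[R]_k),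
    [/\ forall t i, lo t i 0 <= hi t i 0,
        forall v, S v -> exists t, forall i, lo t i 0 <= v i 0 <= hi t i 0 &
        \sum_t \prod_i (hi t i 0 - lo t i 0) <= eps]) ->
  lebesgue_null S.
Proof.
move=> k0 h eps /h[T [lo [hi [lohi Sb vol]]]].
pose ext (u : T -> 'cV[R]_k) (n : nat) : 'cV[R]_k :=
  if insub n is Some j then u (enum_val (j : 'I_#|T|)) else 0.
pose g n := \prod_i (ext hi n i 0 - ext lo n i 0).
have g0 n : 0 <= g n.
  apply: prodr_ge0 => i _; rewrite /ext; case: insub => [j|]; last by rewrite subrr.
  by rewrite subr_ge0.
have gT n : (#|T| <= n)%N -> g n = 0.
  move=> Tn; rewrite /g /ext insubF; last by rewrite ltnNge Tn.
  by rewrite (bigD1 (Ordinal k0)) //= subrr mul0r.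
exists (ext lo), (ext hi); split; last split.
- by move=> n i; rewrite /ext; case: insub => // j.
- move=> v /Sb[t tv]; exists (enum_rank t) => //= i.
  by rewrite /ext valK enum_rankK.
move=> N; apply: le_trans vol.
have -> : \sum_t \prod_i (hi t i 0 - lo t i 0) = \sum_(n < #|T|) g n.
  rewrite (reindex (@enum_val T T)) /=; last exact: onW_bij (@enum_val_bij T).
  by apply: eq_bigr => j _; rewrite /g /ext valK.
rewrite -!(big_mkord xpredT g).
apply: (@le_trans _ _ (\sum_(0 <= n < #|T| + N) g n)).
  rewrite [leRHS](big_cat_nat (n := N)) ?leq_addl //= lerDl.
  exact: sumr_ge0.
rewrite (big_cat_nat (n := #|T|)) ?leq_addr //= gerDl big_nat_cond big1 // => n.
by rewrite andbT => /andP[/gT].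
Qed.

(* The slab is covered by the [q ^ (k - 1)] cells of a grid of mesh [s] in the
   coordinates other than [p]; above each cell the graph has height at most
   [2 * L * s]. The cells are indexed by all functions, the boxes of those that
   do not vanish at [p] being degenerate, so that the total volume is a product. *)
Lemma graph_slab_null (p : 'I_k) (al : 'I_k -> R) (N : nat) :
  lebesgue_null [set v : 'cV[R]_k | v p 0 = \sum_(i | i != p) al i * v i 0 /\
    forall i, `|v i 0| <= N%:R].
Proof.
apply: lebesgue_null_fin; first exact: leq_ltn_trans (ltn_ord p).
(* [D] is the side of the cube of points with coordinates at most [N.+1] in absolute value, [L] a
   sup-norm Lipschitz constant of the graph, and [q] makes the total volume
   [2 * L * D ^+ k / q.+1%:R] at most [eps]. *)
move=> eps eps0; pose D : R := N.+1%:R *+ 2.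
have D0 : 0 < D by rewrite /D pmulrn_lgt0.
pose L := \sum_(i | i != p) `|al i|.
have L0 : 0 <= L by apply: sumr_ge0.
pose q := Num.bound (2 * L * D ^+ k / eps).
have qb : 2 * L * D ^+ k / eps < q.+1%:R.
  have := archi_boundP (_ : 0 <= 2 * L * D ^+ k / eps).
  rewrite !mulr_ge0 ?exprn_ge0 ?invr_ge0 ?(ltW eps0) ?(ltW D0) // => /(_ isT) h.
  by apply: lt_le_trans h _; rewrite ler_nat.
have q0 : 0 < q.+1%:R :> R by [].
pose s := D / q.+1%:R.
have s0 : 0 < s by rewrite divr_gt0.
pose x (t : {ffun 'I_k -> 'I_q.+1}) i : R := - N.+1%:R + s * (t i)%:R.
pose y t := \sum_(i | i != p) al i * x t i.
exists {ffun 'I_k -> 'I_q.+1}.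
exists (fun t : {ffun 'I_k -> 'I_q.+1} => \col_i
  (if i == p then if t p == ord0 then y t - L * s else 0 else x t i)).
exists (fun t : {ffun 'I_k -> 'I_q.+1} => \col_i
  (if i == p then if t p == ord0 then y t + L * s else 0 else x t i + s)).
split.
- move=> t i; rewrite !mxE; case: eqP => _; last by rewrite lerDl ltW.
  have Ls : 0 <= L * s by rewrite mulr_ge0 // ltW.
  by case: eqP => // _; lra.
- move=> v [vp vN].
  (* The cell index is the integer part of [z]; the end point [z = q.+1%:R] is assigned to the last
     cell. *)
  have cell i : exists j : 'I_q.+1, - N.+1%:R + s * j%:R <= v i 0 <= - N.+1%:R + s * j%:R + s.
    pose z := (v i 0 + N.+1%:R) / s.
    have /andP[v1 v2] : - N.+1%:R <= v i 0 <= N.+1%:R.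
      by rewrite -ler_norml; apply: le_trans (vN i) _; rewrite ler_nat.
    have z0 : 0 <= z by rewrite divr_ge0 ?(ltW s0) // -lerBlDr sub0r.
    have /andP[z1 z2] := truncn_itv z0.
    have vz : v i 0 = - N.+1%:R + s * z.
      by rewrite /z mulrC divfK ?gt_eqF // addrC addrK.
    have zq : z <= q.+1%:R.
      rewrite ler_pdivrMr // /s mulrC divfK ?gt_eqF // /D mulr2n lerD2r.
      exact: v2.
    have [tq|tq] := ltnP (Num.truncn z) q.+1.
      exists (Ordinal tq); rewrite vz -addrA !lerD2l /=.
      rewrite (ler_pM2l s0) z1 /= -[X in _ <= _ + X]mulr1 -mulrDr (ler_pM2l s0).
      by rewrite natr1 ltW.
    have zE : z = q.+1%:R.
      by apply/eqP; rewrite eq_le zq; apply: le_trans z1; rewrite ler_nat.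
    exists ord_max; rewrite vz -addrA !lerD2l zE /=.
    rewrite (ler_pM2l s0) ler_nat leqnSn /= -[X in _ <= _ + X]mulr1 -mulrDr (ler_pM2l s0).
    by rewrite natr1.
  have [j vj] := choice cell.
  pose t := [ffun i => if i == p then ord0 else j i].
  exists t => i; rewrite !mxE; case: (eqVneq i p) => [->|ip]; last first.
    by rewrite /x ffunE (negbTE ip).
  rewrite ffunE eqxx /=.
  have : `|v p 0 - y t| <= L * s.
    rewrite vp -sumrB /L mulr_suml; apply: le_trans (ler_norm_sum _ _ _) _.
    apply: ler_sum => l lp; rewrite -mulrBr normrM ler_wpM2l //.
    rewrite /x ffunE (negbTE lp) ler_norml; have /andP[? ?] := vj l.
    by apply/andP; split; lra.
  by rewrite ler_norml => /andP[? ?]; apply/andP; split; lra.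
(* The volume of the box of [t] is the product of the [w i (t i)], so the sum over all [t] turns
   into a product of sums. *)
pose w i (j : 'I_q.+1) : R := if i == p then if j == ord0 then 2 * L * s else 0 else s.
rewrite (eq_bigr (fun t : {ffun 'I_k -> 'I_q.+1} => \prod_i w i (t i))); last first.
  move=> t _; apply: eq_bigr => i _; rewrite !mxE /w; case: eqVneq => [->|_].
    by case: eqP => _; ring.
  by ring.
rewrite -(bigA_distr_bigA w) (bigD1 p) //=.
have -> : \sum_j w p j = 2 * L * s.
  by rewrite (bigD1 ord0) //= big1 ?addr0 /w ?eqxx // => j /negbTE ->.
have wi i : i != p -> \sum_j w i j = D.
  by move=> ip; rewrite /w (negbTE ip) sumr_const card_ord -mulr_natr /s divfK.
rewrite (eq_bigr (fun=> D)); last exact: wi.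
rewrite prodr_const (cardC1 p) card_ord.
have k0 : (0 < k)%N by exact: leq_ltn_trans (ltn_ord p).
have -> : 2 * L * s * D ^+ k.-1 = 2 * L * D ^+ k / q.+1%:R.
  by rewrite -[in RHS](prednK k0) exprS /s; ring.
by rewrite ler_pdivrMr // [eps * _]mulrC -ler_pdivrMr // ltW.
Qed.

End null_sets.

(** The hyperplane is the countable union of its bounded slabs, each of which is a null set. *)
Lemma abs_cont_graph (R : realType) (dO : measure_display) (O : measurableType dO)
    (Q : probability O R) k (Y : O -> 'cV[R]_k) (p : 'I_k) (al : 'I_k -> R) :
  abs_cont Q Y ->
  Q.-negligible [set w | Y w p 0 = \sum_(i | i != p) al i * Y w i 0].
Proof.
move=> aY; pose S N := [set v : 'cV[R]_k | v p 0 = \sum_(i | i != p) al i * v i 0 /\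
    forall i, `|v i 0| <= N%:R].
have nS : Q.-negligible (\bigcup_N (Y @^-1` S N)).
  apply: negligible_bigcup => N.
  have [E [mE YE QE]] := aY _ (graph_slab_null p al N).
  by exists E.
apply: negligibleS nS => w /= Yw; exists (Num.bound (\sum_i `|Y w i 0|)) => //; split=> // i.
apply: ltW; apply: le_lt_trans (archi_boundP _); last exact: sumr_ge0.
by rewrite (bigD1 i) //= lerDl sumr_ge0.
Qed.

(** * Hyperplanes containing the overlaps of the cones *)

Section cones_overlap.
Variables (R : realType) (m d : nat) (A : 'M[R]_(m, d)) (c : 'cV[R]_d).

(** If every index of [f] belonged to [g], then [lamB A c g] would be tight on [f] and so equal
    [lamB A c f]. *)
Lemma basis_not_sub f g : is_basis A f -> is_basis A g ->
  lamB A c f <> lamB A c g -> exists j, forall l, g l != f j.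
Proof.
move=> bf bg fg; apply: contrapT => /forallNP h; apply/fg/esym/lamB_unique => // j.
have [l gl] : exists l, g l = f j.
  apply: contrapT => /forallNP gl; apply: (h j) => l; exact/eqP/gl.
by rewrite -gl lamB_tight.
Qed.

(** Row [j] of the inverse basis matrix has a nonzero entry, say at [p], so the equation can be
    solved for [v p 0]. *)
Lemma xB_coord_hyperplane f j : is_basis A f -> exists p al, forall v,
  xB A f v (f j) 0 = 0 -> v p 0 = \sum_(i | i != p) al i * v i 0.
Proof.
move=> bf; pose M := invmx (colsub f A).
have [p Mp] : exists p, M j p != 0.
  apply: contrapT => /forallNP h; have /matrixP/(_ j j) := mulVmx (proj2 bf).
  rewrite !mxE eqxx big1 => [/eqP|i _]; first by rewrite eq_sym oner_eq0.
  by have /negP := h i; rewrite negbK => /eqP ->; rewrite mul0r.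
exists p, (fun i => - (M j i / M j p)) => v; rewrite xB_coord // mxE (bigD1 p) //=.
move=> /eqP; rewrite addr_eq0 => /eqP vE.
apply: (mulfI Mp); rewrite vE -sumrN mulr_sumr; apply: eq_bigr => i _.
by rewrite mulrA mulrN mulrCA divff ?mulr1 ?mulNr.
Qed.

End cones_overlap.

(** * The limit distribution *)

(** The gauge is the sum of the negative parts of the constrained coordinates. *)
Lemma Hcone_gauge (R : realType) m d (A : 'M[R]_(m, d)) (xb : 'cV[R]_d)
    (f : {ffun 'I_m -> 'I_d}) :
  exists psi : 'cV[R]_m -> R, [/\ continuous psi, forall v, 0 <= psi v &
    forall v, psi v = 0 <-> Hcone A xb f v].
Proof.
pose u v j := (invmx (colsub f A) *m v : 'cV[R]_m) j 0.
pose h j v := if 0 < xb (f j) 0 then 0 else Num.max 0 (- u v j).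
have h0 j v : 0 <= h j v by rewrite /h; case: ifP => // _; rewrite le_max lexx.
exists (fun v => \sum_j h j v); split=> [|v|v].
- apply: sum_continuous => j; rewrite /h; case: (0 < xb (f j) 0); first exact: cst_continuous.
  apply: continuous_max; first exact: cst_continuous.
  have cu : continuous (u^~ j).
    move=> v; apply: (@continuous_comp _ _ _ (mulmx (invmx (colsub f A)))
      (fun x : 'cV[R]_m => x j 0)); first exact: linear_cV_continuous.
    exact: coord_continuous.
  by move=> v; exact: cvgN (cu v).
- exact: sumr_ge0.
split=> [/eqP|vH].
  rewrite psumr_eq0 // => /allP h1 j /negP xj; have := h1 j (mem_index_enum _).
  rewrite /h (negbTE xj) /= => /eqP uj.
  have : - u v j <= Num.max 0 (- u v j) by rewrite le_max lexx orbT.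
  by rewrite uj oppr_le0.
rewrite big1 // => j _; rewrite /h; case: ifPn => // /negP xj.
by rewrite max_l // oppr_le0; exact: vH.
Qed.

Lemma cone_union_gauge (R : realType) m d (A : 'M[R]_(m, d)) (xb : 'cV[R]_d)
    (s : seq {ffun 'I_m -> 'I_d}) :
  exists psi : 'cV[R]_m -> R, [/\ continuous psi, forall v, 0 <= psi v &
    forall v, psi v = 0 <-> cone_union A xb s v].
Proof.
elim: s => [|f s [psi [cpsi psi0 psiC]]].
  exists (cst 1); split=> [|v|v]; [exact: cst_continuous|exact: ler01|].
  by split=> [/eqP|[]//]; rewrite oner_eq0.
have [phi [cphi phi0 phiC]] := Hcone_gauge A xb f.
(* A product vanishes exactly on the union of the two zero sets. *)
exists (fun v => phi v * psi v); split=> [v|v|v].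
- exact: cvgM (cphi v) (cpsi v).
- exact: mulr_ge0.
split=> [/eqP|[g]].
  rewrite mulf_eq0 => /orP[/eqP/phiC fv|/eqP/psiC[g gs gv]].
    by exists f; rewrite ?mem_head.
  by exists g; rewrite // inE gs orbT.
rewrite inE => /predU1P[->|gs] gv; first by rewrite ((phiC v).2 gv) mul0r.
by rewrite ((psiC v).2 (ex_intro2 _ _ g gs gv)) mulr0.
Qed.

(** * Measurability of the limit and of the solvability event *)

Section measurability.
Variables (R : realType) (m d : nat) (A : 'M[R]_(m, d)) (xb : 'cV[R]_d).
Variables (dO : measure_display) (O : measurableType dO).

Lemma measurable_Hcone f (Y : O -> 'cV[R]_m) : rvec_measurable Y ->
  measurable (Y @^-1` Hcone A xb f).
Proof. by move=> mY; apply: closed_preimage_measurable => //; exact: closed_Hcone. Qed.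

Lemma measurable_xB f (Y : O -> 'cV[R]_m) i : rvec_measurable Y ->
  measurable_fun setT (fun w => xB A f (Y w) i 0).
Proof.
move=> mY; apply: (@continuous_rvec_measurable _ _ _ _ Y (fun v => xB A f v i 0)) => //.
move=> v; apply: (@continuous_comp _ _ _ (xB A f) (fun x : 'cV[R]_d => x i 0)).
  exact: xB_continuous.
exact: coord_continuous.
Qed.

Lemma rvec_measurable_weighted n (D : 'I_n -> set 'cV[R]_m)
    (F : 'I_n -> {ffun 'I_m -> 'I_d}) (Y : O -> 'cV[R]_m) :
  rvec_measurable Y -> (forall k, measurable (Y @^-1` D k)) ->
  rvec_measurable (fun w => \sum_(k < n) \1_(D k) (Y w) *: xB A (F k) (Y w)).
Proof.
move=> mY mD i.
rewrite (_ : (fun w => _) = fun w => \sum_(k < n) \1_(Y @^-1` D k) w * xB A (F k) (Y w) i 0).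
  apply: measurable_sum => k; apply: measurable_funM; last exact: measurable_xB.
  exact: measurable_indic.
by apply/funext => w; rewrite summxE; apply: eq_bigr => k _; rewrite mxE.
Qed.

(** By [optimal_basis] the event is a finite union of finite intersections of coordinate sign
    events. *)
Lemma measurable_has_optimal c (Y : O -> 'cV[R]_m) : \rank A = m ->
  rvec_measurable Y -> measurable [set w | has_optimal A c (Y w)].
Proof.
move=> rA mY.
rewrite (_ : [set w | _] = \bigcup_(f in [set f | is_basis A f /\ dual_feasible A c f])
    \bigcap_(i in setT) [set w | 0 <= xB A f (Y w) i 0]).
  apply: fin_bigcup_measurable => [|f _]; first exact: finite_finset.
  apply: fin_bigcap_measurable => [|i _]; first exact: finite_finset.
  have := measurable_xB f i mY measurableT (measurable_itv `[0 : R, +oo[).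
  by rewrite setTI preimage_itvcy.
apply/seteqP; split=> w /=.
  by move=> /(optimal_basis _ _ rA)[f [bf df f0]]; exists f => // i _; exact: f0.
by move=> [f /= [bf df] f0]; apply/(optimal_basis _ _ rA); exists f; split=> // i; exact: f0.
Qed.
End measurability.

Lemma lim_vec'_eq (R : realType) m d (A : 'M[R]_(m, d)) (xb : 'cV[R]_d)
    (Ks : seq {ffun 'I_m -> 'I_d}) v : uniq Ks ->
  (forall f g, f \in Ks -> g \in Ks -> f != g ->
    ~ (Hcone A xb f v /\ Hcone A xb g v)) ->
  lim_vec A xb Ks v = lim_vec' A xb Ks v.
Proof.
move=> uK h; apply: eq_bigr => k _; congr (_ *: _).
rewrite !indicE; congr (nat_of_bool _)%:R; apply/idP/idP; rewrite !inE.
  by case.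
move=> kv; split=> // -[j /= jk jv].
apply: (h _ _ (mem_tnth j (in_tuple Ks)) (mem_tnth k (in_tuple Ks))).
  by apply/eqP => /(elimT (tuple_uniqP (in_tuple Ks)) uK) jk'; rewrite jk' ltnn in jk.
by split.
Qed.

(** Some index [f j] is not in [g]; on the overlap the two basic solutions agree, so this coordinate
    of [xB A f] vanishes. *)
Lemma Hcone_overlap_negligible (R : realType) m d (A : 'M[R]_(m, d)) b c
    (Ks : seq {ffun 'I_m -> 'I_d}) xb (dO : measure_display)
    (O : measurableType dO) (Q : probability O R) (Y : O -> 'cV[R]_m) f g :
  (forall f, f \in Ks <->
     [/\ is_basis A f, dual_feasible A c f & forall i, 0 <= xB A f b i 0]) ->
  lp_optimal A c b xb -> (forall x, lp_optimal A c b x -> x = xb) ->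
  {in Ks &, injective (lamB A c)} -> abs_cont Q Y ->
  f \in Ks -> g \in Ks -> f != g ->
  Q.-negligible [set w | Hcone A xb f (Y w) /\ Hcone A xb g (Y w)].
Proof.
move=> KsP xbO xbU lamI aY fK gK fg.
have [bf bg] := (Ks_basis KsP fK, Ks_basis KsP gK).
have [|j jg] := @basis_not_sub _ _ _ A c _ _ bf bg.
  by move/(lamI _ _ fK gK)/eqP; rewrite (negbTE fg).
have [p [al pal]] := xB_coord_hyperplane j bf.
apply: negligibleS (abs_cont_graph p al aY) => w /= [fv gv]; apply: pal.
rewrite (Hcone_agree KsP xbO xbU lamI fK gK fv gv).
by rewrite xB_expand expand_off.
Qed.

Theorem theorem3p2 (R : realType) (m d : nat) (A : 'M[R]_(m, d))
  (b : 'cV[R]_m) (c : 'cV[R]_d) (Ks : seq {ffun 'I_m -> 'I_d}) (xb : 'cV[R]_d)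
  (dO : measure_display) (O : measurableType dO) (P : probability O R)
  (dO' : measure_display) (O' : measurableType dO') (Q : probability O' R)
  (r : nat -> R) (m0 : nat) (bn : nat -> O -> 'cV[R]_m) (G : O' -> 'cV[R]_m)
  (xs : nat -> O -> 'cV[R]_d) :
  (* A of full rank m <= d *)
  (m <= d)%N -> \rank A = m ->
  (* Ks = I_1, ..., I_K : the dual feasible bases with x(I,b) >= 0 *)
  uniq Ks ->
  (forall f, f \in Ks <->
     [/\ is_basis A f, dual_feasible A c f & forall i, 0 <= xB A f b i 0]) ->
  (* (A2): xb = x*(b) is the unique optimal solution of (P_b) *)
  lp_optimal A c b xb -> (forall x, lp_optimal A c b x -> x = xb) ->
  (* (A3) *)
  (forall j k : 'I_(size Ks), (j < k)%N ->
     lamB A c (tnth (in_tuple Ks) j) <> lamB A c (tnth (in_tuple Ks) k)) ->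
  (* stochastic setting *)
  r @ \oo --> +oo ->
  (0 < m0 <= m)%N ->
  (forall n, rvec_measurable (bn n)) ->
  (forall n w (i : 'I_m), (m0 <= i)%N -> bn n w i 0 = b i 0) ->
  (* (B1) *)
  rvec_measurable G ->
  (forall w (i : 'I_m), (m0 <= i)%N -> G w i 0 = 0) ->
  abs_cont Q (fun w => proj_first m0 (G w)) ->
  conv_dist P Q (fun n w => r n *: (bn n w - b)) G ->
  (* (B2) *)
  (fun n => P [set w | has_optimal A c (bn n w)]) @ \oo --> 1%E ->
  (* measurable choice of optimal solutions x*(b_n) *)
  (forall n, rvec_measurable (xs n)) ->
  (forall n w, has_optimal A c (bn n w) -> lp_optimal A c (bn n w) (xs n w)) ->
  conv_dist P Q (fun n w => r n *: (xs n w - xb)) (fun w => lim_vec A xb Ks (G w))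
  /\ (abs_cont Q G ->
      conv_dist P Q (fun n w => r n *: (xs n w - xb)) (fun w => lim_vec' A xb Ks (G w))).
Proof.
move=> _ rA uK KsP xbO xbU A3 roo _ mbn _ mG _ _ GG Popt mxs xsO.
have lamI : {in Ks &, injective (lamB A c)}.
  move=> f g /(tnthP (in_tuple Ks))[j ->] /(tnthP (in_tuple Ks))[k ->] jk.
  by case: (ltngtP j k) => [/A3|/A3/nesym|/val_inj ->].
have mH k : measurable (G @^-1` Hcone A xb (tnth (in_tuple Ks) k)).
  exact: measurable_Hcone.
have mlim : rvec_measurable (fun w => lim_vec A xb Ks (G w)).
  apply: rvec_measurable_weighted => // k.
  rewrite (_ : G @^-1` _ = (G @^-1` Hcone A xb (tnth (in_tuple Ks) k)) `\`
    \bigcup_(j in [set j : 'I_(size Ks) | (j < k)%N])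
      (G @^-1` Hcone A xb (tnth (in_tuple Ks) j))) //; apply: measurableD => //.
  by apply: fin_bigcup_measurable => [|j _]; [exact: finite_finset|exact: mH].
have mlim' : rvec_measurable (fun w => lim_vec' A xb Ks (G w)).
  exact: rvec_measurable_weighted.
have mGn n : rvec_measurable (fun w => r n *: (bn n w - b)).
  exact: rvec_measurable_affine.
have [e /= e0 eb] := (nbhs_ballP _ _).1 (near_lim_vec rA KsP xbO xbU lamI).
(* For positive [r n] this is the event that [bn n] is at distance at least [e] from [b], written
   for the scaled vectors to match [conv_dist_small]. *)
pose S n := [set w | e * r n <= `|r n *: (bn n w - b)|].
pose H n := [set w | has_optimal A c (bn n w)].
have mS n : measurable (S n).
  apply: (@closed_preimage_measurable _ _ _ _ _ [set v | e * r n <= `|v|]) => //.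
  exact: closed_norm_ge.
have mHn n : measurable (H n) by exact: measurable_has_optimal.
(* The exceptional event: there is no optimum, or [bn n] is far from [b]. *)
have mB n : measurable (~` H n `|` S n) by apply: measurableU => //; exact: measurableC.
have B0 : (fun n => fine (P (~` H n `|` S n))) @ \oo --> 0.
  have S0 : (fun n => fine (P (S n))) @ \oo --> 0 by exact: conv_dist_small GG roo e0.
  have H1 : (fun n => 1 - fine (P (H n))) @ \oo --> 0.
    rewrite -(subrr 1); apply: cvgB; [exact: cvg_cst|exact: fine_cvg].
  have HS : (fun n => (1 - fine (P (H n))) + fine (P (S n))) @ \oo --> 0.
    by rewrite -(addr0 0); exact: cvgD.
  apply: (@squeeze_cvgr _ _ _ _ (cst 0)
    (fun n => (1 - fine (P (H n))) + fine (P (S n)))) => //.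
    apply: nearW => n; rewrite fine_ge0 //= -lee_fin EFinD EFinB -!EFin_fineP //.
    by rewrite -probability_setC //; apply: measureU2 => //; exact: measurableC.
  exact: cvg_cst.
have [psi [cpsi psi0 psiC]] := cone_union_gauge A xb Ks.
have [cC wC] := lim_vec_within KsP xbO xbU lamI (fun _ => id).
have main : conv_dist P Q (fun n w => r n *: (xs n w - xb))
    (lim_vec A xb Ks \o G).
  apply: (conv_dist_mapping cpsi psi0 psiC cC wC mGn mG _ mlim mB B0 _ GG).
    by move=> n; exact: rvec_measurable_affine.
  have r0 : \forall n \near \oo, 0 < r n by exact: (cvgryPgt _).1 roo 0.
  apply: filterS r0 => n rn w.
  move/not_orP => [/contrapT Hw /negP]; rewrite -ltNge normrZ gtr0_norm // mulrC.
  rewrite ltr_pM2r // => wb; apply: eb => //; last exact: xsO.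
  by rewrite -ball_normE /= distrC.
split=> // aG; apply: (conv_dist_ae_eq mlim mlim' _ main).
(* There are finitely many pairs of bases, so the null overlaps can be discarded simultaneously. *)
have : {ae Q, forall w, forall fg : {ffun 'I_m -> 'I_d} * {ffun 'I_m -> 'I_d},
    fg.1 \in Ks -> fg.2 \in Ks -> fg.1 != fg.2 ->
    ~ (Hcone A xb fg.1 (G w) /\ Hcone A xb fg.2 (G w))}.
  apply: (@filter_forall _ _ (fun fg => [set w | fg.1 \in Ks -> fg.2 \in Ks ->
    fg.1 != fg.2 -> ~ (Hcone A xb fg.1 (G w) /\ Hcone A xb fg.2 (G w))])
    (almost_everywhere Q) _) => -[f g].
  have [fK|] := boolP (f \in Ks); last by move=> _; apply: aeW => w /=.
  have [gK|] := boolP (g \in Ks); last by move=> _; apply: aeW => w /=.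
  have [|fg] := boolP (f == g); first by move=> _; apply: aeW => w /=.
  apply: negligibleS (Hcone_overlap_negligible KsP xbO xbU lamI aG fK gK fg).
  by move=> w /= /not_implyP[_ /not_implyP[_ /not_implyP[_ /contrapT]]].
by apply: filterS => w h; apply: lim_vec'_eq => // f g fK gK fg; exact: (h (f, g)).
Qed.
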